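(* Two sequences $\{(\widehat{\mathbb{L}}(\Delta^n),\partial)\}_{n\ge0}$ and $\{(\widehat{\mathbb{L}}(\Delta^n),\partial')\}_{n\ge0}$ of compatible models of $\mathbf\Delta$ are isomorphic: for each $n\ge0$ there is a DGL isomorphism $$\varphi_n\colon(\widehat{\mathbb{L}}(\Delta^n),\partial)\xrightarrow{\cong}(\widehat{\mathbb{L}}(\Delta^n),\partial'),$$ and these commute with the coface maps, i.e. $\varphi_n\circ\delta_i=\delta_i\circ\varphi_{n-1}$ for $n\ge 1$ and $i=0,\dots,n$, and satisfy $\mathrm{Im}(\varphi_n-\mathrm{id})\subset\widehat{\mathbb{L}}^{\ge2}(\Delta^n)$.
   Context: The base field is $\mathbb{Q}$. A differential graded Lie algebra (DGL) is a $\mathbb{Z}$-graded Lie algebra $L$ with a linear derivation $\partial$ of degree $-1$, $\partial^2=0$; with $L^1=L$, $L^n=[L,L^{n-1}]$, it is complete if $L\cong\varprojlim_n L/L^n$. ''DGL'' means complete DGL. $\mathbb{L}(V)$ is the free graded Lie algebra on $V$ and $\widehat{\mathbb{L}}(V)=\varprojlim_n\mathbb{L}(V)/\mathbb{L}^{>n}(V)$ its completion; $\widehat{\mathbb{L}}^{\ge k}(V)$ is the subspace of (possibly infinite) sums of elements of bracket length $\ge k$. For a differential $\partial$ on $\widehat{\mathbb L}(V)$, $\partial_1$ is its linear part. A Maurer-Cartan element is $a\in L_{-1}$ with $\partial a+\frac12[a,a]=0$. $\widehat{\mathbb{L}}(\Delta^n)$ denotes the free complete graded Lie algebra on generators $a_{i_0\dots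 i_p}$ of degree $p-1$, one for each $0\le i_0<\dots<i_p\le n$, $0\le p\le n$. Let $d a_{i_0\dots i_p}=\sum_{j=0}^p(-1)^ja_{i_0\dots\widehat{i_j}\dots i_p}$ ($da_i=0$), and let $\delta_i\colon\widehat{\mathbb{L}}(\Delta^{n-1})\to\widehat{\mathbb{L}}(\Delta^n)$, $0\le i\le n$, be the Lie morphism $\delta_i(a_{j_0\dots j_p})=a_{\ell_0\dots\ell_p}$, with $\ell_k=j_k$ if $j_k<i$ and $\ell_k=j_k+1$ if $j_k\ge i$. A sequence of compatible models of $\mathbf\Delta$ is a family of DGL's $\{(\widehat{\mathbb{L}}(\Delta^n),\partial)\}_{n\ge0}$ such that: (1) each $a_i$ is a Maurer-Cartan element; (2) $\partial_1=d$; (3) each $\delta_i$ is a DGL morphism. *)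

(* Defs.v *)
From HB Require Import structures.
From mathcomp Require Import all_boot all_order all_algebra.
From mathcomp Require Import boolp classical_sets functions.
From mathcomp Require Import ring zify.

Set Implicit Arguments.
Unset Strict Implicit.
Unset Printing Implicit Defensive.

Import Order.TTheory GRing.Theory Num.Theory.
Local Open Scope classical_set_scope.
Local Open Scope ring_scope.

Definition koszul (p q : int) : rat := (-1) ^ (p * q).

(* A graded vector space is the direct sum of its homogeneous parts: the
   carrier consists of finite sums of homogeneous elements.  Over the rationals
   antisymmetry and the Jacobi identity are the only axioms on the bracket. *)
Record gradedLie := GradedLie {
  gl_sort :> lmodType rat;
  homog : int -> set gl_sort;
  bracket : gl_sort -> gl_sort -> gl_sort;
  homog0 : forall p, homog p 0;
  homogP : forall p a x y, homog p x -> homog p y -> homog p (a *: x + y);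
  homog_sum : forall x, exists (s : seq int) (c : int -> gl_sort),
    (forall p, homog p (c p)) /\ x = \sum_(p <- s) c p;
  homog_direct : forall (s : seq int) (c : int -> gl_sort), uniq s ->
    (forall p, homog p (c p)) -> \sum_(p <- s) c p = 0 ->
    forall p, p \in s -> c p = 0;
  bracketPl : forall a x y z,
    bracket (a *: x + y) z = a *: bracket x z + bracket y z;
  bracketPr : forall a x y z,
    bracket x (a *: y + z) = a *: bracket x y + bracket x z;
  homog_bracket : forall p q x y,
    homog p x -> homog q y -> homog (p + q) (bracket x y);
  bracketC : forall p q x y, homog p x -> homog q y ->
    bracket x y = - (koszul p q *: bracket y x);
  jacobi : forall p q x y z, homog p x -> homog q y ->
    bracket x (bracket y z) =
      bracket (bracket x y) z + koszul p q *: bracket y (bracket x z)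
}.

Inductive spanned (V : lmodType rat) (S : set V) : V -> Prop :=
| spanned0 : spanned S 0
| spannedP a x y : S x -> spanned S y -> spanned S (a *: x + y).

(* [lcs L k] is the term L^(k+1) of the lower central series:
   L^1 = L and L^(k+1) = [L, L^k]. *)
Fixpoint lcs (L : gradedLie) (k : nat) : set L :=
  if k is k'.+1
  then spanned [set z | exists x y, lcs k' y /\ z = bracket x y]
  else setT.

(* The map from L to lim_k L/L^k is bijective; limits of graded vector spaces
   are taken in each degree. *)
Definition complete (L : gradedLie) : Prop := forall p : int,
  (forall x : L, homog p x -> (forall k, lcs k x) -> x = 0) /\
  (forall u : nat -> L, (forall k, homog p (u k)) ->
     (forall k, lcs k (u k.+1 - u k)) ->
     exists x : L, homog p x /\ forall k, lcs k (x - u k)).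

Definition lie_morphism (L M : gradedLie) (f : L -> M) : Prop :=
  (forall p x, homog p x -> homog p (f x)) /\
  (forall x y, f (bracket x y) = bracket (f x) (f y)).

(* DGL's are complete by convention. *)
Definition is_dgl (L : gradedLie) (D : {linear L -> L}) : Prop :=
  [/\ complete L,
      forall p x, homog p x -> homog (p - 1) (D x),
      forall p x y, homog p x ->
        D (bracket x y) = bracket (D x) y + (-1) ^ p *: bracket x (D y)
    & forall x, D (D x) = 0].

Definition dgl_morphism (L M : gradedLie) (D : {linear L -> L})
    (E : {linear M -> M}) (f : {linear L -> M}) : Prop :=
  lie_morphism f /\ forall x, f (D x) = E (f x).

Definition dgl_isomorphism (L M : gradedLie) (D : {linear L -> L})
    (E : {linear M -> M}) (f : {linear L -> M}) : Prop :=
  dgl_morphism D E f /\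
  exists g : {linear M -> L}, [/\ dgl_morphism E D g, cancel f g & cancel g f].

Definition maurer_cartan (L : gradedLie) (D : {linear L -> L}) (a : L) : Prop :=
  homog (-1) a /\ D a + 2^-1 *: bracket a a = 0.

(* A basis of a finite-dimensional graded space V. *)
Record gradedSet := GradedSet { gset :> finType; gdeg : gset -> int }.

Inductive magma (X : Type) := Leaf of X | Node of magma X & magma X.
Arguments Leaf {X}.
Arguments Node {X}.

Fixpoint eq_magma (X : eqType) (s t : magma X) : bool :=
  match s, t with
  | Leaf x, Leaf y => x == y
  | Node a b, Node c d => eq_magma a c && eq_magma b d
  | _, _ => false
  end.

Lemma eq_magmaP (X : eqType) : Equality.axiom (@eq_magma X).
Proof.
move=> s t; apply: (iffP idP) => [|<-]; last first.
  by elim: s => [x|a IHa b IHb] /=; rewrite ?eqxx ?IHa.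
elim: s t => [x|a IHa b IHb] [y|c d] //=; first by move/eqP->.
by case/andP=> /IHa -> /IHb ->.
Qed.

HB.instance Definition _ (X : eqType) := hasDecEq.Build (magma X) (@eq_magmaP X).

Fixpoint wt (X : Type) (t : magma X) : nat :=
  match t with Leaf _ => 1 | Node a b => wt a + wt b end.

Fixpoint tdeg (X : gradedSet) (t : magma X) : int :=
  match t with Leaf x => gdeg x | Node a b => tdeg a + tdeg b end.

Lemma wt_gt0 (X : Type) (t : magma X) : (0 < wt t)%N.
Proof. by elim: t => //= a IHa b IHb; rewrite addn_gt0 IHa. Qed.

(* Formal series of nonassociative monomials in X. *)
Definition series (X : gradedSet) := magma X -> rat^o.
HB.instance Definition _ X := GRing.Lmodule.on (series X).

Definition smul (X : gradedSet) (f g : series X) : series X :=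
  fun t => if t is Node a b then f a * g b else 0.

Fixpoint mono (X : gradedSet) (t : magma X) : series X :=
  match t with
  | Leaf x => fun s => (s == Leaf x)%:R
  | Node a b => smul (mono a) (mono b)
  end.

(* The ideal, in the free nonassociative algebra (the span of the monomials),
   whose quotient is the free graded Lie algebra L(V). *)
Inductive lie_ideal (X : gradedSet) : series X -> Prop :=
| lie_ideal0 : lie_ideal 0
| lie_idealP a f g : lie_ideal f -> lie_ideal g -> lie_ideal (a *: f + g)
| lie_idealMl t f : lie_ideal f -> lie_ideal (smul (mono t) f)
| lie_idealMr t f : lie_ideal f -> lie_ideal (smul f (mono t))
| lie_ideal_anti s t :
    lie_ideal (mono (Node s t) + koszul (tdeg s) (tdeg t) *: mono (Node t s))
| lie_ideal_jac r s t :
    lie_ideal (mono (Node r (Node s t)) - mono (Node (Node r s) t)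
               - koszul (tdeg r) (tdeg s) *: mono (Node s (Node r t))).

(* Writing I for [lie_ideal] and N for the free nonassociative algebra, a
   series f defines the compatible family of the classes of its truncations in
   L(V)/L^(>n)(V) = N/(I + N^(>n)).  This maps series onto lim_n L(V)/L^(>n)(V),
   and [lie_null] is the kernel. *)
Definition lie_null (X : gradedSet) (f : series X) : Prop :=
  forall n, exists2 g, lie_ideal g & forall t, (wt t <= n)%N -> f t = g t.

(* Only finitely many degrees occur: the limit is taken degree by degree. *)
Definition bounded (X : gradedSet) (f : series X) : Prop :=
  exists N : nat, forall t, (N < `|tdeg t|)%N -> f t = 0.

Definition boundedb (X : gradedSet) : {pred series X} := fun f => `[< bounded f >].

Lemma boundedb_submod X : submod_closed (@boundedb X).
Proof.
split; first by apply/asboolP; exists 0%N.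
move=> a f g /asboolP [M hM] /asboolP [N hN]; apply/asboolP.
exists (maxn M N) => t; rewrite gtn_max => /andP [/hM fM /hN gN].
by rewrite !fctE fM gN scaler0 addr0.
Qed.

HB.instance Definition _ X :=
  GRing.isSubmodClosed.Build rat (series X) (@boundedb X) (boundedb_submod X).

Record bseries (X : gradedSet) :=
  BSeries { bval :> series X; _ : bval \in @boundedb X }.
HB.instance Definition _ X := [isSub for @bval X].
HB.instance Definition _ X := [Choice of bseries X by <:].
HB.instance Definition _ X := [SubChoice_isSubLmodule of bseries X by <:].

Definition lie_nullb (X : gradedSet) : {pred bseries X} :=
  fun f => `[< lie_null (bval f) >].

Lemma lie_nullP X a (f g : series X) :
  lie_null f -> lie_null g -> lie_null (a *: f + g).
Proof.
move=> nf ng n; have [f0 If ef] := nf n; have [g0 Ig eg] := ng n.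
exists (a *: f0 + g0); first exact: lie_idealP.
by move=> t lt; rewrite !fctE ef // eg.
Qed.

Lemma lie_null0 X : lie_null (0 : series X).
Proof. by move=> n; exists 0; first exact: lie_ideal0. Qed.

Lemma lie_nullb_submod X : submod_closed (@lie_nullb X).
Proof.
split; first by apply/asboolP; exact: lie_null0.
by move=> a f g /asboolP nf /asboolP ng; apply/asboolP; exact: lie_nullP.
Qed.

HB.instance Definition _ X :=
  GRing.isSubmodClosed.Build rat (bseries X) (@lie_nullb X) (lie_nullb_submod X).

Definition lhat_sort (X : gradedSet) : Type := (Quotient.quot (@lie_nullb X)).
HB.instance Definition _ X := GRing.Zmodule.on (lhat_sort X).

Definition cls (X : gradedSet) (f : bseries X) : lhat_sort X :=
  (\pi_((Quotient.quot (@lie_nullb X))) f)%qT.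

Definition rep (X : gradedSet) (x : lhat_sort X) : bseries X :=
  repr (x : (Quotient.quot (@lie_nullb X))).

Section Quotient.
Variable X : gradedSet.
Implicit Types (f g h : series X) (F G : bseries X) (x y z : lhat_sort X).

Lemma repK x : cls (rep x) = x.
Proof. exact: (@reprK _ (Quotient.quot (@lie_nullb X)) x). Qed.

Lemma clsE F G : cls F = cls G <-> lie_null (bval F - bval G).
Proof.
split=> [/eqP | H].
  by rewrite -[_ == _]/(_ == _ %[mod _])%qT -Quotient.idealrBE => /asboolP.
by apply/eqP; rewrite -[_ == _]/(_ == _ %[mod _])%qT -Quotient.idealrBE; apply/asboolP.
Qed.

Lemma clsD F G : cls (F + G) = cls F + cls G.
Proof. exact: (@raddfD _ _ (\pi_((Quotient.quot (@lie_nullb X))))%qT). Qed.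

Lemma clsB F G : cls (F - G) = cls F - cls G.
Proof. exact: (@raddfB _ _ (\pi_((Quotient.quot (@lie_nullb X))))%qT). Qed.

Lemma cls0 : cls 0 = 0 :> lhat_sort X.
Proof. exact: (@raddf0 _ _ (\pi_((Quotient.quot (@lie_nullb X))))%qT). Qed.

Lemma cls_eq0 F : cls F = 0 <-> lie_null (bval F).
Proof. by rewrite -cls0 clsE subr0. Qed.

Definition lhat_scale (a : rat) x : lhat_sort X := cls (a *: rep x).

Lemma rep_null F : lie_null (bval (rep (cls F)) - bval F).
Proof. by apply/clsE; rewrite repK. Qed.

Lemma clsZ_subproof a F : cls (a *: F) = lhat_scale a (cls F).
Proof.
apply/esym/clsE; rewrite -scalerBr -[_ *: _]addr0.
by apply: lie_nullP; [exact: rep_null | exact: lie_null0].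
Qed.

Lemma lhat_scaleA a b x : lhat_scale a (lhat_scale b x) = lhat_scale (a * b) x.
Proof. by rewrite -[x]repK -!clsZ_subproof scalerA. Qed.
Lemma lhat_scale1 : left_id 1 lhat_scale.
Proof. by move=> x; rewrite -[x]repK -!clsZ_subproof scale1r. Qed.
Lemma lhat_scaleDr : right_distributive lhat_scale +%R.
Proof.
by move=> a x y; rewrite -[x]repK -[y]repK -clsD -!clsZ_subproof scalerDr clsD.
Qed.
Lemma lhat_scaleDl x : {morph lhat_scale^~ x : a b / a + b}.
Proof. by move=> a b; rewrite -[x]repK -!clsZ_subproof scalerDl clsD. Qed.

HB.instance Definition _ := GRing.Zmodule_isLmodule.Build rat (lhat_sort X)
  lhat_scaleA lhat_scale1 lhat_scaleDr lhat_scaleDl.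

Lemma clsZ a F : cls (a *: F) = a *: cls F.
Proof. exact: clsZ_subproof. Qed.

Lemma cls_sum I (r : seq I) (F : I -> bseries X) :
  cls (\sum_(i <- r) F i) = \sum_(i <- r) cls (F i).
Proof.
by elim/big_rec2: _ => [|i y z _ <-]; [exact: cls0 | rewrite clsD].
Qed.

Lemma smulPl a f g h : smul (a *: f + g) h = a *: smul f h + smul g h.
Proof.
apply/funext=> -[v|s t]; rewrite !fctE /= ?mulrDl -?scalerAl //.
by rewrite scaler0 addr0.
Qed.

Lemma smulPr a f g h : smul h (a *: f + g) = a *: smul h f + smul h g.
Proof.
apply/funext=> -[v|s t]; rewrite !fctE /= ?mulrDr -?scalerAr //.
by rewrite scaler0 addr0.
Qed.

Lemma smul0l h : smul 0 h = 0.
Proof. by apply/funext=> -[v|s t] //=; exact: mul0r. Qed.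

Lemma smul0r h : smul h 0 = 0.
Proof. by apply/funext=> -[v|s t] //=; exact: mulr0. Qed.

Lemma smul_suml I (r : seq I) (a : I -> rat) (f : I -> series X) h :
  smul (\sum_(i <- r) a i *: f i) h = \sum_(i <- r) a i *: smul (f i) h.
Proof.
elim: r => [|i r IH]; first by rewrite !big_nil smul0l.
by rewrite !big_cons smulPl IH.
Qed.

Lemma smul_sumr I (r : seq I) (a : I -> rat) (f : I -> series X) h :
  smul h (\sum_(i <- r) a i *: f i) = \sum_(i <- r) a i *: smul h (f i).
Proof.
elim: r => [|i r IH]; first by rewrite !big_nil smul0r.
by rewrite !big_cons smulPr IH.
Qed.

Lemma monoE (t s : magma X) : mono t s = (s == t)%:R.
Proof.
elim: t s => [v|a IHa b IHb] [w|c d] //=.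
by rewrite IHa IHb -natrM mulnb.
Qed.

Fixpoint dtrees (n : nat) : seq (magma X) :=
  if n is n'.+1 then
    [seq Leaf v | v <- enum X] ++ [seq Node s t | s <- dtrees n', t <- dtrees n']
  else [::].

Definition trees (n : nat) : seq (magma X) :=
  undup [seq t <- dtrees n | (wt t <= n)%N].

Lemma trees_uniq n : uniq (trees n). Proof. exact: undup_uniq. Qed.

Lemma mem_trees n t : (t \in trees n) = (wt t <= n)%N.
Proof.
rewrite mem_undup mem_filter; case: leqP => //=.
elim: n t => [|n IH] t /=; first by rewrite leqNgt wt_gt0.
move=> lt; rewrite mem_cat; apply/orP; case: t lt => [v|a b] /= lt.
  by left; apply: map_f; rewrite mem_enum.
right; apply: allpairs_f; apply: IH; rewrite -ltnS; apply: leq_trans lt.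
  by rewrite -addn1 leq_add2l wt_gt0.
by rewrite -add1n leq_add2r wt_gt0.
Qed.

Definition trunc n f : series X := \sum_(t <- trees n) f t *: mono t.

Lemma sum_monoE (r : seq (magma X)) (c : magma X -> rat) t : uniq r ->
  (\sum_(s <- r) c s *: mono s : series X) t = if t \in r then c t else 0.
Proof.
move=> ur; rewrite [LHS](_ : _ = \sum_(s <- r) c s * (t == s)%:R); last first.
  by elim/big_rec2: _ => //= s y z _ <-; rewrite !fctE monoE.
case: ifPn => [tr | tr].
  rewrite (bigD1_seq t) //= eqxx mulr1 big1 ?addr0 // => s /negPf.
  by rewrite eq_sym => ->; rewrite mulr0.
rewrite big_seq big1 // => s sr; case: eqP => [e|_]; last by rewrite mulr0.
by rewrite e sr in tr.
Qed.

Lemma truncE n f t : trunc n f t = if (wt t <= n)%N then f t else 0.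
Proof. by rewrite /trunc sum_monoE ?trees_uniq // mem_trees. Qed.

Lemma lie_idealD f g : lie_ideal f -> lie_ideal g -> lie_ideal (f + g).
Proof. by move=> If Ig; rewrite -[f]scale1r; exact: lie_idealP. Qed.

Lemma lie_idealZ a f : lie_ideal f -> lie_ideal (a *: f).
Proof.
by move=> If; rewrite -[_ *: _]addr0; apply: lie_idealP => //; exact: lie_ideal0.
Qed.

Lemma lie_ideal_sum I (r : seq I) (f : I -> series X) :
  (forall i, lie_ideal (f i)) -> lie_ideal (\sum_(i <- r) f i).
Proof.
by move=> H; elim/big_rec: _ => [|i y _]; [exact: lie_ideal0 | exact: lie_idealD].
Qed.

Lemma lie_null_ideal f : lie_ideal f -> lie_null f.
Proof. by move=> If n; exists f. Qed.

Lemma lie_nullD f g : lie_null f -> lie_null g -> lie_null (f + g).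
Proof. by move=> nf ng; rewrite -[f]scale1r; exact: lie_nullP. Qed.

Lemma lie_nullN f : lie_null f -> lie_null (- f).
Proof.
move=> nf; rewrite -scaleN1r -[_ *: _]addr0.
by apply: lie_nullP => //; exact: lie_null0.
Qed.

Lemma lie_null_closed f :
  (forall n, exists2 g, lie_null g & forall t, (wt t <= n)%N -> f t = g t) ->
  lie_null f.
Proof.
move=> H n; have [g ng eg] := H n; have [h Ih eh] := ng n.
by exists h => // t lt; rewrite eg // eh.
Qed.

Lemma wt_Node_le (s t : magma X) n :
  (wt (Node s t) <= n)%N -> ((wt s <= n) && (wt t <= n))%N.
Proof.
move=> /= le; rewrite (leq_trans _ le) ?leq_addr //.
by rewrite (leq_trans _ le) ?leq_addl.
Qed.

Lemma smul_agree n f f' g g' :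
  (forall t, (wt t <= n)%N -> f t = f' t) ->
  (forall t, (wt t <= n)%N -> g t = g' t) ->
  forall t, (wt t <= n)%N -> smul f g t = smul f' g' t.
Proof.
by move=> ef eg [v|s t] // /wt_Node_le /andP [ls lt] /=; rewrite ef // eg.
Qed.

Lemma trunc_agree n f t : (wt t <= n)%N -> f t = trunc n f t.
Proof. by rewrite truncE => ->. Qed.

Lemma smul_nulll f g : lie_null f -> lie_null (smul f g).
Proof.
move=> nf n; have [f0 If ef] := nf n.
exists (smul f0 (trunc n g)); last exact: smul_agree ef (@trunc_agree n g).
rewrite smul_sumr; apply: lie_ideal_sum => t; apply: lie_idealZ.
exact: lie_idealMr.
Qed.

Lemma smul_nullr f g : lie_null g -> lie_null (smul f g).
Proof.
move=> nf n; have [f0 If ef] := nf n.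
exists (smul (trunc n f) f0); last exact: smul_agree (@trunc_agree n f) ef.
rewrite smul_suml; apply: lie_ideal_sum => t; apply: lie_idealZ.
exact: lie_idealMl.
Qed.

Lemma smul_trunc n f g : smul (trunc n f) (trunc n g) =
  \sum_(s <- trees n) \sum_(t <- trees n) (f s * g t) *: mono (Node s t).
Proof.
rewrite smul_suml; apply: eq_bigr => s _; rewrite smul_sumr scaler_sumr.
by apply: eq_bigr => t _; rewrite scalerA.
Qed.

Definition shom (p : int) f := forall t, tdeg t != p -> f t = 0.

Lemma shomP p a f g : shom p f -> shom p g -> shom p (a *: f + g).
Proof. by move=> hf hg t ne; rewrite !fctE hf // hg // scaler0 addr0. Qed.

Lemma shom_smul p q f g : shom p f -> shom q g -> shom (p + q) (smul f g).
Proof.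
move=> hf hg [v|s t] //= ne; have [es|/hf ->] := eqVneq (tdeg s) p; last by rewrite mul0r.
have [et|/hg ->] := eqVneq (tdeg t) q; last by rewrite mulr0.
by rewrite es et eqxx in ne.
Qed.

Lemma shom_mono (t : magma X) : shom (tdeg t) (mono t).
Proof. by move=> s ne; rewrite monoE; case: (eqVneq s t) ne => [->|//]; rewrite eqxx. Qed.

Lemma shom_bounded p f : shom p f -> f \in @boundedb X.
Proof.
move=> hf; apply/asboolP; exists `|p|%N => t lt; apply: hf.
by apply: contraTneq lt => ->; rewrite ltnn.
Qed.

Lemma smul_null_anti p q f g : shom p f -> shom q g ->
  lie_null (smul f g + koszul p q *: smul g f).
Proof.
move=> hf hg n.
exists (smul (trunc n f) (trunc n g) + koszul p q *: smul (trunc n g) (trunc n f)).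
  rewrite !smul_trunc [X in _ *: X]exchange_big /= scaler_sumr -big_split /=.
  apply: lie_ideal_sum => s; rewrite scaler_sumr -big_split /=.
  apply: lie_ideal_sum => t.
  have [es|/hf ->] := eqVneq (tdeg s) p; last first.
    by rewrite mul0r mulr0 !scale0r scaler0 addr0; exact: lie_ideal0.
  have [et|/hg ->] := eqVneq (tdeg t) q; last first.
    by rewrite mul0r mulr0 !scale0r scaler0 addr0; exact: lie_ideal0.
  rewrite [X in _ + X]scalerA [X in _ + X *: _]mulrC [g t * _]mulrC.
  rewrite -[X in _ + X]scalerA -scalerDr.
  by apply: lie_idealZ; rewrite -es -et; exact: lie_ideal_anti.
move=> t lt; rewrite !fctE.
by congr (_ + _ *: _); apply: smul_agree lt; exact: trunc_agree.
Qed.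

Lemma smul_null_jac p q f g h : shom p f -> shom q g ->
  lie_null (smul f (smul g h) - smul (smul f g) h
            - koszul p q *: smul g (smul f h)).
Proof.
move=> hf hg n.
exists (smul (trunc n f) (smul (trunc n g) (trunc n h))
        - smul (smul (trunc n f) (trunc n g)) (trunc n h)
        - koszul p q *: smul (trunc n g) (smul (trunc n f) (trunc n h))).
  have -> : smul (trunc n f) (smul (trunc n g) (trunc n h)) =
      \sum_(r <- trees n) \sum_(s <- trees n)
      \sum_(t <- trees n) (f r * g s * h t) *: mono (Node r (Node s t)).
    rewrite smul_suml; apply: eq_bigr => r _; rewrite smul_suml smul_sumr scaler_sumr.
    apply: eq_bigr => s _; rewrite scalerA !smul_sumr scaler_sumr.
    by apply: eq_bigr => t _; rewrite scalerA.
  have -> : smul (smul (trunc n f) (trunc n g)) (trunc n h) =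
      \sum_(r <- trees n) \sum_(s <- trees n)
      \sum_(t <- trees n) (f r * g s * h t) *: mono (Node (Node r s) t).
    rewrite smul_suml smul_suml; apply: eq_bigr => r _.
    rewrite [smul (mono r) _]smul_sumr smul_suml scaler_sumr; apply: eq_bigr => s _.
    rewrite scalerA smul_sumr scaler_sumr.
    by apply: eq_bigr => t _; rewrite scalerA.
  have -> : smul (trunc n g) (smul (trunc n f) (trunc n h)) =
      \sum_(r <- trees n) \sum_(s <- trees n)
      \sum_(t <- trees n) (f r * g s * h t) *: mono (Node s (Node r t)).
    rewrite exchange_big /= smul_suml; apply: eq_bigr => s _.
    rewrite [smul (trunc n f) _]smul_suml smul_sumr scaler_sumr.
    apply: eq_bigr => r _; rewrite scalerA !smul_sumr scaler_sumr.
    by apply: eq_bigr => t _; rewrite scalerA [g s * _]mulrC.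
  rewrite scaler_sumr -!sumrB; apply: lie_ideal_sum => r.
  rewrite scaler_sumr -!sumrB; apply: lie_ideal_sum => s.
  rewrite scaler_sumr -!sumrB; apply: lie_ideal_sum => t.
  have [er|/hf ->] := eqVneq (tdeg r) p; last first.
    by rewrite !mul0r !scale0r scaler0 !subr0; exact: lie_ideal0.
  have [es|/hg ->] := eqVneq (tdeg s) q; last first.
    by rewrite mulr0 !mul0r !scale0r scaler0 !subr0; exact: lie_ideal0.
  rewrite [X in _ - X]scalerA [X in _ - X *: _]mulrC -[X in _ - X]scalerA -!scalerBr.
  by apply: lie_idealZ; rewrite -er -es; exact: lie_ideal_jac.
have aF := @trunc_agree n f; have aG := @trunc_agree n g; have aH := @trunc_agree n h.
move=> t lt; rewrite !fctE.
by congr (_ - _ - _ *: _); do ![apply: smul_agree (lt) | apply: smul_agree | done].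
Qed.

Definition hpart (p : int) f : series X := fun t => if tdeg t == p then f t else 0.

Lemma hpartP p a f g : hpart p (a *: f + g) = a *: hpart p f + hpart p g.
Proof.
by apply/funext=> t; rewrite /hpart !fctE; case: ifP; rewrite // scaler0 addr0.
Qed.

Lemma shom_hpart p f : shom p (hpart p f).
Proof. by move=> t /negPf ne; rewrite /hpart ne. Qed.

Lemma hpart_id p f : shom p f -> hpart p f = f.
Proof.
move=> hf; apply/funext => t; rewrite /hpart.
by have [//|/hf ->] := eqVneq (tdeg t) p.
Qed.

Lemma hpart_other p q f : p != q -> shom q f -> hpart p f = 0.
Proof.
move=> ne hf; apply/funext => t; rewrite /hpart.
by have [e|//] := eqVneq (tdeg t) p; apply: hf; rewrite e.
Qed.

Lemma hpart_smulr p q f g : shom q f ->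
  hpart p (smul f g) = smul f (hpart (p - q) g).
Proof.
move=> hf; apply/funext => -[v|s t]; rewrite /hpart /=; first by case: ifP.
have [es|/hf ->] := eqVneq (tdeg s) q; last by rewrite !mul0r; case: ifP.
by rewrite es addrC -subr_eq opprK; case: ifP; rewrite ?mulr0 // addrC subr_eq addrC.
Qed.

End Quotient.

Section Lhat.
Variable X : gradedSet.
Implicit Types (f g h : series X) (F G H : bseries X) (x y z : lhat_sort X).

Lemma shomD p f g : shom p f -> shom p g -> shom p (f + g).
Proof. by move=> hf hg; rewrite -[f]scale1r; exact: shomP. Qed.

Lemma shomZ p a f : shom p f -> shom p (a *: f).
Proof. by move=> hf; rewrite -[_ *: _]addr0; apply: shomP. Qed.

Lemma shomN p f : shom p f -> shom p (- f).
Proof. by move=> hf; rewrite -scaleN1r; exact: shomZ. Qed.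

Lemma hpart_smull p q f g : shom q g ->
  hpart p (smul f g) = smul (hpart (p - q) f) g.
Proof.
move=> hg; apply/funext => -[v|s t]; rewrite /hpart /=; first by case: ifP.
have [et|/hg ->] := eqVneq (tdeg t) q; last by rewrite !mulr0; case: ifP.
by rewrite et -subr_eq opprK; case: ifP; rewrite ?mul0r // eq_sym subr_eq eq_sym => ->.
Qed.

Lemma hpart0 p : hpart p 0 = 0 :> series X.
Proof. by apply/funext => t; rewrite /hpart; case: ifP. Qed.

Lemma lie_ideal_hpart p f : lie_ideal f -> lie_ideal (hpart p f).
Proof.
have hom_case q r (g : series X) : shom q g -> lie_ideal g -> lie_ideal (hpart r g).
  move=> hg Ig; have [->|ne] := eqVneq r q; first by rewrite hpart_id.
  by rewrite (hpart_other ne hg); exact: lie_ideal0.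
move=> If; elim: If p => {f} [|a f g _ If _ Ig|t f _ If|t f _ If|s t|r s t] p.
- by rewrite hpart0; exact: lie_ideal0.
- by rewrite hpartP; exact: lie_idealP.
- by rewrite (hpart_smulr _ _ (@shom_mono _ t)); exact: lie_idealMl.
- by rewrite (hpart_smull _ _ (@shom_mono _ t)); exact: lie_idealMr.
- apply: (hom_case (tdeg s + tdeg t)); last exact: lie_ideal_anti.
  apply: shomD; first exact: (@shom_mono _ (Node s t)).
  by apply: shomZ; rewrite addrC; exact: (@shom_mono _ (Node t s)).
- apply: (hom_case (tdeg r + (tdeg s + tdeg t))); last exact: lie_ideal_jac.
  apply: shomD.
    apply: shomD; first exact: (@shom_mono _ (Node r (Node s t))).
    by apply: shomN; rewrite addrA; exact: (@shom_mono _ (Node (Node r s) t)).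
  by apply/shomN/shomZ; rewrite addrCA; exact: (@shom_mono _ (Node s (Node r t))).
Qed.

Lemma lie_null_hpart p f : lie_null f -> lie_null (hpart p f).
Proof.
move=> nf n; have [g Ig eg] := nf n; exists (hpart p g).
  exact: lie_ideal_hpart.
by move=> t lt; rewrite /hpart eg.
Qed.

Lemma bval_bounded F : bounded (bval F).
Proof. by case: F => f bf; apply/asboolP. Qed.

Lemma bounded_smul F G : smul (bval F) (bval G) \in @boundedb X.
Proof.
have [M hM] := bval_bounded F; have [N hN] := bval_bounded G; apply/asboolP.
exists (M + N)%N => -[v|s t] //= lt.
have [ls|ls] := ltnP M `|tdeg s|; first by rewrite hM ?mul0r.
have [lt'|lt'] := ltnP N `|tdeg t|; first by rewrite hN ?mulr0.
by exfalso; lia.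
Qed.

Definition bsmul F G : bseries X := BSeries (bounded_smul F G).

Definition bhom p f (hf : shom p f) : bseries X := BSeries (shom_bounded hf).

Lemma bseries_eq F G : bval F = bval G -> F = G.
Proof. exact: val_inj. Qed.

Lemma bvalP a F G : bval (a *: F + G) = a *: bval F + bval G.
Proof. by []. Qed.

Lemma bval_sum I (r : seq I) (F : I -> bseries X) :
  bval (\sum_(i <- r) F i) = \sum_(i <- r) bval (F i).
Proof. by elim/big_rec2: _ => [|i f G _ <-]. Qed.

Definition lhat_homog (p : int) : set (lhat_sort X) :=
  [set x | exists2 F, shom p (bval F) & x = cls F].

Definition lhat_bracket x y : lhat_sort X := cls (bsmul (rep x) (rep y)).

Lemma lhat_bracketE F G : lhat_bracket (cls F) (cls G) = cls (bsmul F G).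
Proof.
apply/clsE; set F' := rep _; set G' := rep _.
have -> : bval (bsmul F' G') - bval (bsmul F G) =
    smul (bval F' - bval F) (bval G') + smul (bval F) (bval G' - bval G).
  apply/funext => -[v|s t]; rewrite !fctE /= ?subr0 ?addr0 //.
  by rewrite mulrBl mulrBr addrA subrK.
by apply: lie_nullD; [apply: smul_nulll | apply: smul_nullr]; exact: rep_null.
Qed.

Lemma lhat_homog0 p : lhat_homog p 0.
Proof. by exists 0; rewrite ?cls0. Qed.

Lemma lhat_homogP p a x y :
  lhat_homog p x -> lhat_homog p y -> lhat_homog p (a *: x + y).
Proof.
move=> [F hF ->] [G hG ->]; exists (a *: F + G); last by rewrite clsD clsZ.
exact: shomP.
Qed.

Lemma lhat_homog_sum x : exists (s : seq int) (c : int -> lhat_sort X),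
  (forall p, lhat_homog p (c p)) /\ x = \sum_(p <- s) c p.
Proof.
pose F := rep x; have [N hN] := bval_bounded F.
pose s := [seq i%:Z - N%:Z | i <- iota 0 (N + N).+1].
pose c p := bhom (@shom_hpart X p (bval F)).
exists s, (fun p => cls (c p)); split.
  by move=> p; exists (c p) => //; exact: shom_hpart.
rewrite -cls_sum -[LHS]repK; congr cls; apply: bseries_eq; rewrite bval_sum.
apply/funext => t; rewrite fct_sumE.
have us : uniq s.
  by rewrite map_inj_uniq ?iota_uniq // => i j /addIr [].
case: (ltnP N `|tdeg t|) => lt.
  by rewrite hN // big1 // => p _ /=; rewrite /hpart hN // if_same.
rewrite (bigD1_seq (tdeg t)) //=; last first.
  apply/mapP; exists (absz (tdeg t + N%:Z)); last by lia.
  by rewrite mem_iota; lia.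
by rewrite /hpart eqxx big1 ?addr0 // => p /negPf; rewrite eq_sym => ->.
Qed.

Lemma lhat_homog_direct (s : seq int) (c : int -> lhat_sort X) : uniq s ->
  (forall p, lhat_homog p (c p)) -> \sum_(p <- s) c p = 0 ->
  forall p, p \in s -> c p = 0.
Proof.
move=> us hc; have /choice [F hF] : forall p, exists F : bseries X,
    shom p (bval F) /\ c p = cls F.
  by move=> p; have [F] := hc p; exists F.
rewrite (eq_bigr (fun p => cls (F p))); last by move=> p _; case: (hF p).
rewrite -cls_sum => /cls_eq0; rewrite bval_sum => nF p ps.
have [hp ->] := hF p; apply/cls_eq0.
have /(_ p) := lie_null_hpart _ nF; congr lie_null.
rewrite (bigD1_seq p) //= -[bval (F p)]scale1r hpartP hpart_id // scale1r.
rewrite (_ : hpart p _ = 0) ?addr0 //.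
elim/big_rec: _ => [|q f ne e]; first exact: hpart0.
rewrite -[bval (F q)]scale1r hpartP e addr0 (@hpart_other X p q) ?scaler0 //.
  by rewrite eq_sym.
by case: (hF q).
Qed.

Lemma lhat_bracketPl a x y z :
  lhat_bracket (a *: x + y) z = a *: lhat_bracket x z + lhat_bracket y z.
Proof.
rewrite -[x]repK -[y]repK -[z]repK -clsZ -clsD !lhat_bracketE -clsZ -clsD.
by congr cls; apply: bseries_eq; exact: smulPl.
Qed.

Lemma lhat_bracketPr a x y z :
  lhat_bracket x (a *: y + z) = a *: lhat_bracket x y + lhat_bracket x z.
Proof.
rewrite -[x]repK -[y]repK -[z]repK -clsZ -clsD !lhat_bracketE -clsZ -clsD.
by congr cls; apply: bseries_eq; exact: smulPr.
Qed.

Lemma lhat_homog_bracket p q x y : lhat_homog p x -> lhat_homog q y ->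
  lhat_homog (p + q) (lhat_bracket x y).
Proof.
move=> [F hF ->] [G hG ->]; rewrite lhat_bracketE; exists (bsmul F G) => //.
exact: shom_smul.
Qed.

Lemma lhat_bracketC p q x y : lhat_homog p x -> lhat_homog q y ->
  lhat_bracket x y = - (koszul p q *: lhat_bracket y x).
Proof.
move=> [F hF ->] [G hG ->]; rewrite !lhat_bracketE -clsZ.
apply/eqP; rewrite -addr_eq0 -clsD; apply/eqP/cls_eq0.
exact: smul_null_anti.
Qed.

Lemma lhat_jacobi p q x y z : lhat_homog p x -> lhat_homog q y ->
  lhat_bracket x (lhat_bracket y z) = lhat_bracket (lhat_bracket x y) z
    + koszul p q *: lhat_bracket y (lhat_bracket x z).
Proof.
move=> [F hF ->] [G hG ->]; rewrite -[z]repK !lhat_bracketE -clsZ.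
apply/eqP; rewrite -subr_eq0 opprD addrA -!clsB; apply/eqP/cls_eq0.
exact: smul_null_jac.
Qed.

Definition lhat : gradedLie := GradedLie lhat_homog0 lhat_homogP lhat_homog_sum
  lhat_homog_direct lhat_bracketPl lhat_bracketPr lhat_homog_bracket
  lhat_bracketC lhat_jacobi.

Definition gen (v : X) : lhat := cls (bhom (@shom_mono X (Leaf v))).

(* The filtration by bracket length, possibly infinite sums included. *)
Definition lhat_ge (k : nat) : set lhat :=
  [set x | exists2 F : bseries X,
     forall t, (wt t < k)%N -> bval F t = 0 & x = cls F].

End Lhat.

Section Complete.
Variable X : gradedSet.
Implicit Types (f g h : series X) (F G H : bseries X) (x y z : lhat X).

Lemma lcs_lhat_ge k x : lcs k x -> lhat_ge k.+1 x.
Proof.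
elim: k x => [|k IH] x /=.
  by move=> _; exists (rep x); rewrite ?repK // => t; rewrite ltnS leqNgt wt_gt0.
elim=> [|a {}x y [u [v [/IH [G oG ->] ->]]] _ [H oH ->]].
  by exists 0; rewrite ?cls0.
rewrite -[u]repK /bracket /= lhat_bracketE -clsZ -clsD.
exists (a *: bsmul (rep u) G + H) => // t lt; rewrite bvalP !fctE oH // addr0.
case: t lt => [v'|s t] /= lt; first exact: scaler0.
rewrite [bval G t]oG ?mulr0 ?scaler0 //.
by move: lt; have := wt_gt0 s; lia.
Qed.

Lemma lhat_ge_sep x : (forall k, lhat_ge k x) -> x = 0.
Proof.
rewrite -[x]repK => H; apply/cls_eq0; apply: lie_null_closed => n.
have [F oF /clsE nF] := H n.+1.
by exists (bval (rep x) - bval F) => // t lt; rewrite !fctE oF // subr0.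
Qed.

Let lsupp n p (v : X) (g : series X) :=
  forall t, g t != 0 -> (wt t).+1 = n /\ gdeg v + tdeg t = p.

Let lsuppP n p v a f g : lsupp n p v f -> lsupp n p v g -> lsupp n p v (a *: f + g).
Proof.
move=> sf sg t; rewrite !fctE.
have [ft|/sf //] := eqVneq (f t) 0; have [gt|/sg //] := eqVneq (g t) 0.
by rewrite ft gt scaler0 addr0 eqxx.
Qed.

Lemma left_normed (s u : magma X) : exists g : X -> series X,
  (forall v, lsupp (wt (Node s u)) (tdeg (Node s u)) v (g v)) /\
  lie_ideal (mono (Node s u) - \sum_v smul (mono (Leaf v)) (g v)).
Proof.
elim: s u => [w|a IHa b IHb] u.
  exists (fun v => if v == w then mono u else 0); split.
    move=> v t; have [->|_] := eqVneq v w; last by rewrite eqxx.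
    by rewrite monoE; have [->|] := eqVneq t u; rewrite ?eqxx.
  rewrite (bigD1 w) //= eqxx big1; last by move=> v /negPf ->; exact: smul0r.
  by rewrite addr0 subrr; exact: lie_ideal0.
have [g1 [s1 I1]] := IHa (Node b u); have [g2 [s2 I2]] := IHb (Node a u).
set k := koszul (tdeg a) (tdeg b).
exists (fun v => (- k) *: g2 v + g1 v); split.
  move=> v; apply: lsuppP.
    move=> t /s2 [/= -> ->]; split; first by rewrite addnCA addnA.
    by rewrite addrCA addrA.
  by move=> t /s1 [/= -> ->]; rewrite addnA addrA.
have J := lie_ideal_jac a b u; rewrite -/k in J.
rewrite (eq_bigr (fun v => - k *: smul (mono (Leaf v)) (g2 v)
                           + smul (mono (Leaf v)) (g1 v))); last first.
  by move=> v _; exact: smulPr.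
rewrite big_split /= -scaler_sumr.
have e (A B C S1 S2 : series X) : A - (- k *: S2 + S1) =
    (-1) *: (B - A - k *: C) + ((- k) *: (C - S2) + (B - S1)).
  apply/funext => t; rewrite !fctE /GRing.scale /=; ring.
exact: (eq_ind _ (@lie_ideal X) (lie_idealP (-1) J (lie_idealP (- k) I2 I1)) _ (esym (e _ _ _ _ _))).
Qed.

Lemma sum_trees m n (f : magma X -> rat) : (m <= n)%N ->
  (forall t, wt t != m -> f t = 0) ->
  \sum_(t <- trees X n) f t = \sum_(t <- trees X m) f t.
Proof.
move=> le f0; have H r : \sum_(t <- r) f t = \sum_(t <- r | wt t == m) f t.
  by rewrite [RHS]big_mkcond; apply: eq_bigr => t _; case: ifPn => // /f0.
apply: etrans (H _) _; apply: etrans _ (esym (H _)).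
rewrite -big_filter -[RHS]big_filter.
apply: perm_big; apply: uniq_perm; rewrite ?filter_uniq ?trees_uniq // => t.
by rewrite !mem_filter !mem_trees; case: eqP => // ->; rewrite leqnn.
Qed.

Lemma spanned_sum (V : lmodType rat) (S : set V) I (r : seq I) (y : I -> V) :
  (forall i, S (y i)) -> spanned S (\sum_(i <- r) y i).
Proof.
move=> Sy; elim/big_rec: _ => [|i z _ Sz]; first exact: spanned0.
by rewrite -[y i]scale1r; exact: spannedP.
Qed.

Lemma lhat_ge_decomp k x : lhat_ge k.+2 x ->
  exists y : X -> lhat X, (forall v, lhat_ge k.+1 (y v)) /\
    x = \sum_v bracket (gen v) (y v).
Proof.
move=> [F oF ->]; have [N bN] := bval_bounded F; set f := bval F.
have /choice [g0 hg0] : forall st : magma X * magma X, exists g : X -> series X,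
  (forall v, lsupp (wt (Node st.1 st.2)) (tdeg (Node st.1 st.2)) v (g v)) /\
  lie_ideal (mono (Node st.1 st.2) - \sum_v smul (mono (Leaf v)) (g v)).
  by move=> [s t]; exact: left_normed.
pose g t : X -> series X := if t is Node s u then g0 (s, u) else fun=> 0.
have sg t v : lsupp (wt t) (tdeg t) v (g t v).
  case: t => [w|s u] /=; first by move=> t; rewrite eqxx.
  by have [] := hg0 (s, u).
pose G v : series X := fun w => \sum_(t <- trees X (wt w).+1) f t * g t v w.
have term0 v w t : f t = 0 \/ (wt w).+1 != wt t \/ gdeg v + tdeg w != tdeg t ->
    f t * g t v w = 0.
  move=> [->|H]; first by rewrite mul0r.
  have [->|/sg [e1 e2]] := eqVneq (g t v w) 0; first by rewrite mulr0.
  by case: H; rewrite ?e1 ?e2 eqxx.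
have bG v : G v \in @boundedb X.
  apply/asboolP; exists (N + `|gdeg v|)%N => w lt; apply: big1 => t _; apply: term0.
  have [e|] := eqVneq (gdeg v + tdeg w) (tdeg t); last by right; right.
  by left; apply: bN; rewrite -e; lia.
have oG v w : (wt w < k.+1)%N -> G v w = 0.
  move=> lt; apply: big1 => t _; apply: term0.
  have [e|] := eqVneq (wt w).+1 (wt t); last by right; left.
  by left; apply: oF; rewrite -e.
exists (fun v => cls (BSeries (bG v))); split.
  by move=> v; exists (BSeries (bG v)) => //; exact: oG.
rewrite (eq_bigr (fun v => cls (bsmul (bhom (@shom_mono X (Leaf v))) (BSeries (bG v))))); last first.
  by move=> v _; exact: lhat_bracketE.
rewrite -cls_sum; apply/clsE => n; rewrite bval_sum /=.
exists (\sum_(t <- trees X n) f t *: (mono t - \sum_v smul (mono (Leaf v)) (g t v))).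
  apply: lie_ideal_sum => -[v|s u].
    by rewrite [f _]oF // scale0r; exact: lie_ideal0.
  by apply: lie_idealZ; have [] := hg0 (s, u).
move=> w lw.
rewrite (eq_bigr (fun t => f t *: mono t - \sum_v f t *: smul (mono (Leaf v)) (g t v))); last first.
  by move=> t _; rewrite scalerBr scaler_sumr.
rewrite sumrB exchange_big /= !fctE -/(trunc n f) -trunc_agree //; congr (_ - _).
rewrite !fct_sumE; apply: eq_bigr => v _; rewrite fct_sumE.
case: w lw => [v'|s w] lw /=.
  by rewrite big1 // => t _; exact: scaler0.
rewrite [G v w](esym (@sum_trees (wt w).+1 n _ _ _)).
- rewrite mulr_sumr; apply: eq_bigr => t _; rewrite !fctE /= /GRing.scale /=; ring.
- by apply: leq_trans lw => /=; rewrite -add1n leq_add2r wt_gt0.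
- by move=> t ne; apply: term0; right; left; rewrite eq_sym.
Qed.

Lemma lhat_ge_lcs k x : lhat_ge k.+1 x -> lcs k x.
Proof.
elim: k x => [//|k IH] x /lhat_ge_decomp [y [oy ->]].
by apply: spanned_sum => v; exists (gen v), (y v); split=> //; exact: IH.
Qed.

Lemma lhat_complete : complete (lhat X).
Proof.
move=> p; split=> [x _ H|u hu Cu].
  apply: lhat_ge_sep => -[|k]; last exact: lcs_lhat_ge.
  by exists (rep x); rewrite ?repK.
have /choice [D hD] : forall k, exists D : bseries X,
    [/\ shom p (bval D), forall t, (wt t < k.+1)%N -> bval D t = 0
      & u k.+1 - u k = cls D].
  move=> k; have [D0 oD0 e0] := lcs_lhat_ge (Cu k).
  have [D1 hD1 e1] : homog p (u k.+1 - u k).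
    by rewrite addrC -scaleN1r; apply: homogP.
  exists (bhom (@shom_hpart X p (bval D0))); split; first exact: shom_hpart.
    by move=> t lt /=; rewrite /hpart oD0 // if_same.
  rewrite e1; apply/clsE => /=.
  rewrite -(hpart_id hD1) addrC -scaleN1r -hpartP scaleN1r addrC.
  by apply: lie_null_hpart; apply/clsE; rewrite -e1.
have [U hU eU] := hu 0%N.
pose S : series X := fun t => bval U t + \sum_(0 <= j < wt t) bval (D j) t.
have hS : shom p S.
  move=> t ne; rewrite /S hU // add0r big1 // => j _.
  by have [hDj _ _] := hD j; exact: hDj.
exists (cls (bhom hS)); split; first by exists (bhom hS).
move=> k; apply: lhat_ge_lcs.
have -> : u k = cls (U + \sum_(0 <= j < k) D j).
  elim: k => [|k IH]; first by rewrite big_nil addr0.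
  have [_ _ e] := hD k.
  by rewrite big_nat_recr //= addrA clsD -e -IH addrC subrK.
rewrite -clsB; exists (bhom hS - (U + \sum_(0 <= j < k) D j)) => // t lt.
rewrite [LHS](_ : _ = S t - (bval U t + bval (\sum_(0 <= j < k) D j) t)) //.
rewrite bval_sum fct_sumE /S (@big_cat_nat _ _ _ (wt t) 0 k) //=.
rewrite [X in _ + (_ + X)]big1_seq ?addr0 ?subrr // => j /andP [_].
rewrite mem_index_iota => /andP [le _].
by have [_ oD _] := hD j; exact: oD.
Qed.

End Complete.

Record gradedMap (X Y : gradedSet) :=
  GradedMap { gmap :> X -> Y; gdeg_gmap : forall v, gdeg (gmap v) = gdeg v }.

Fixpoint tmap (X Y : Type) (m : X -> Y) (t : magma X) : magma Y :=
  match t with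
  | Leaf v => Leaf (m v)
  | Node s u => Node (tmap m s) (tmap m u)
  end.

Section Functor.
Variables (X Y : gradedSet) (m : gradedMap X Y).
Implicit Types (f g : series X) (F G : bseries X).

Lemma tdeg_tmap (t : magma X) : tdeg (tmap m t) = tdeg t.
Proof. by elim: t => [v|s IHs u IHu] /=; rewrite ?gdeg_gmap ?IHs ?IHu. Qed.

(* The monomials mapped to t by m. *)
Fixpoint preimages (t : magma Y) : seq (magma X) :=
  match t with
  | Leaf y => [seq Leaf v | v <- enum X & m v == y]
  | Node s u => [seq Node s' u' | s' <- preimages s, u' <- preimages u]
  end.

Definition push (f : series X) : series Y := fun t => \sum_(s <- preimages t) f s.

Lemma preimagesP s t : s \in preimages t -> tdeg s = tdeg t /\ wt s = wt t.
Proof.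
elim: t s => [y|a IHa b IHb] s /=.
  by case/mapP=> v; rewrite mem_filter => /andP [/eqP <- _] ->; rewrite /= gdeg_gmap.
by case/allpairsP=> -[s1 s2] /= [/IHa [e1 e2] /IHb [e3 e4] ->] /=; rewrite e1 e2 e3 e4.
Qed.

Lemma pushP a f g : push (a *: f + g) = a *: push f + push g.
Proof.
apply/funext => t; rewrite [RHS](_ : _ = a *: push f t + push g t) //.
by rewrite /push scaler_sumr -big_split.
Qed.

Lemma push_smul f g : push (smul f g) = smul (push f) (push g).
Proof.
apply/funext => -[y|a b]; rewrite /push /=; first by rewrite big_map big1.
by rewrite big_allpairs_dep /= big_distrlr.
Qed.

Lemma push_mono (t : magma X) : push (mono t) = mono (tmap m t).
Proof.
elim: t => [v|s IHs u IHu]; last by rewrite [LHS]push_smul IHs IHu.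
apply/funext => t; rewrite monoE /push; case: t => [y|a b] /=; last first.
  by rewrite big_allpairs_dep big1 // => s _; rewrite big1.
rewrite big_map big_filter /= big_enum_cond /=.
rewrite (_ : (Leaf y == Leaf (m v)) = (m v == y)); last by rewrite eq_sym.
have [e|ne] := boolP (m v == y).
  rewrite (bigD1 v) //= eqxx big1 ?addr0 // => w /andP [_ /negPf nw].
  by rewrite -[_ == _]/(w == v) nw.
rewrite big1 // => w ew; have [e|//] := eqVneq (Leaf w) (Leaf v).
by case: e ew => ->; rewrite (negPf ne).
Qed.

Lemma lie_ideal_push f : lie_ideal f -> lie_ideal (push f).
Proof.
have push0 : push 0 = 0 by apply/funext => t; rewrite /push big1.
have pushD g h : push (g + h) = push g + push h.
  by rewrite -[g]scale1r pushP !scale1r.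
have pushZ a g : push (a *: g) = a *: push g.
  by rewrite -[_ *: _]addr0 pushP push0 addr0.
have pushN g : push (- g) = - push g by rewrite -!scaleN1r pushZ.
elim=> {f} [|a f g _ If _ Ig|t f _ If|t f _ If|s t|r s t].
- by rewrite push0; exact: lie_ideal0.
- by rewrite pushP; exact: lie_idealP.
- by rewrite push_smul push_mono; exact: lie_idealMl.
- by rewrite push_smul push_mono; exact: lie_idealMr.
- rewrite pushD pushZ !push_mono -(tdeg_tmap s) -(tdeg_tmap t).
  exact: lie_ideal_anti.
- rewrite !pushD !pushN pushZ !push_mono -(tdeg_tmap r) -(tdeg_tmap s).
  exact: lie_ideal_jac.
Qed.

Lemma lie_null_push f : lie_null f -> lie_null (push f).
Proof.
move=> nf n; have [g Ig eg] := nf n; exists (push g); first exact: lie_ideal_push.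
move=> t lt; rewrite /push big_seq [RHS]big_seq; apply: eq_bigr => s.
by move=> /preimagesP [_ e]; rewrite eg // e.
Qed.

Lemma bounded_push F : push (bval F) \in @boundedb Y.
Proof.
have [N hN] := bval_bounded F; apply/asboolP; exists N => t lt.
by rewrite /push big_seq big1 // => s /preimagesP [e _]; rewrite hN // e.
Qed.

Definition bpush F : bseries Y := BSeries (bounded_push F).

(* The Lie morphism extending m. *)
Definition lhat_map (x : lhat X) : lhat Y := cls (bpush (rep x)).

Lemma lhat_mapE F : lhat_map (cls F) = cls (bpush F).
Proof.
apply/clsE => /=; rewrite addrC -scaleN1r -pushP scaleN1r addrC.
by apply: lie_null_push; exact: rep_null.
Qed.

Lemma lhat_map_linear : linear lhat_map.
Proof.
move=> a x y; rewrite -[x]repK -[y]repK -clsZ -clsD !lhat_mapE -clsZ -clsD.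
by congr cls; apply: bseries_eq; exact: pushP.
Qed.

HB.instance Definition _ :=
  GRing.isLinear.Build rat (lhat X) (lhat Y) _ lhat_map lhat_map_linear.

Lemma lhat_map_lie : lie_morphism lhat_map.
Proof.
split=> [p _ [F hF ->]|x y].
  rewrite lhat_mapE; exists (bpush F) => // t ne /=.
  rewrite /push big_seq big1 // => s /preimagesP [e _].
  by apply: hF; rewrite e.
rewrite -[bracket x y]/(lhat_bracket x y) -[RHS]/(lhat_bracket _ _).
rewrite -[x]repK -[y]repK lhat_bracketE !lhat_mapE lhat_bracketE.
by congr cls; apply: bseries_eq; exact: push_smul.
Qed.

Lemma lhat_map_gen (v : X) : lhat_map (gen v) = gen (m v).
Proof. by rewrite lhat_mapE; congr cls; apply: bseries_eq; exact: push_mono. Qed.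

End Functor.

Local Close Scope classical_set_scope.

(* The sequence i_0 < ... < i_p is encoded by the set of its terms. *)
Definition face (n : nat) := {A : {set 'I_n.+1} | A != finset.set0}.

Definition simplex (n : nat) : gradedSet :=
  @GradedSet (face n : finType) (fun A => #|val A|%:Z - 2).

Definition LDelta (n : nat) : gradedLie := lhat (simplex n).

(* a_A is 0 for the empty set A. *)
Definition agen (n : nat) (A : {set 'I_n.+1}) : LDelta n :=
  if insub A is Some s then gen (s : simplex n) else 0.

(* The index of k in the increasing enumeration of A is the number of elements
   of A below k. *)
Definition dDelta (n : nat) (A : {set 'I_n.+1}) : LDelta n :=
  \sum_(k in A) (-1) ^+ #|[set j in A | (j < k)%N]| *: agen (A :\ k).

Section Coface.
Variables (n : nat) (i : 'I_n.+2).

Lemma coface_neq0 (A : face n) : lift i @: val A != finset.set0.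
Proof. by rewrite imset_eq0 (valP A). Qed.

Definition coface_set (A : simplex n) : simplex n.+1 :=
  exist (fun B : {set 'I_n.+2} => B != finset.set0) (lift i @: val A) (coface_neq0 A).

Lemma gdeg_coface (A : simplex n) : gdeg (coface_set A) = gdeg A.
Proof. by rewrite /= card_imset //; exact: lift_inj. Qed.

Definition coface : {linear LDelta n -> LDelta n.+1} :=
  lhat_map (GradedMap gdeg_coface).

Lemma coface_lie : lie_morphism coface.
Proof. exact: lhat_map_lie. Qed.

Lemma coface_agen (A : {set 'I_n.+1}) : coface (agen A) = agen (lift i @: A).
Proof.
rewrite /agen; case: insubP => [s _ <-|]; last first.
  by rewrite negbK => /eqP ->; rewrite imset0 insubF ?linear0 // eqxx.
rewrite [LHS]lhat_map_gen /=.
by rewrite (insubT (fun B : {set 'I_n.+2} => B != finset.set0) (coface_neq0 s)).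
Qed.

End Coface.

(* Meant for d with values in the span V of the generators: V is a complement
   of the elements of bracket length at least 2, so this determines d. *)
Definition linear_part (X : gradedSet) (D : {linear lhat X -> lhat X})
    (d : X -> lhat X) : Prop :=
  forall v, lhat_ge 2 (D (gen v) - d v).

Definition compatible_models (D : forall n, {linear LDelta n -> LDelta n}) :=
  [/\ forall n, is_dgl (D n),
      forall n (i : 'I_n.+1), maurer_cartan (D n) (agen [set i]),
      forall n, linear_part (D n) (fun A : simplex n => dDelta (val A))
    & forall n (i : 'I_n.+2), dgl_morphism (D n) (D n.+1) (coface i)].

(* Main.v *)
From HB Require Import structures.
Require Import Defs.
From mathcomp Require Import all_boot all_order all_algebra.
From mathcomp Require Import boolp classical_sets functions finset.
From mathcomp Require Import ring zify.

Set Implicit Arguments.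
Unset Strict Implicit.
Unset Printing Implicit Defensive.

Import GRing.Theory Num.Theory.
Local Open Scope ring_scope.

(** The isomorphisms are built by obstruction theory along bracket length.

    A compatible family [phi] is determined by the images [u p] of the top
    generators a_{0...p}: every other generator of [LDelta n] is the image of a
    top generator under a unique composite of cofaces, so [phi n] must be the
    Lie morphism [family_map u n] given by the corresponding face maps applied
    to the [u p].  Conversely every such family commutes with the cofaces
    ([family_map_face]), and it remains to choose [u n], by induction on n, so
    that [phi n] commutes with the differentials on a_{0...n}; on the other
    generators this follows from naturality ([defect_face]).

    The defect theta = D' phi - phi D is a derivation along [phi] and vanishes
    on proper faces.  Suppose that e = theta(a_{0...n}) has bracket length at
    least k, where k >= 2.  Since D a_{0...n} is its linear part, a combination
    of proper faces, plus longer brackets, D' e = - theta (D a_{0...n}) has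
    length at least k + 1: the leading part of e is a cycle for the linear part
    d of the differential.  If it is a boundary d w, then replacing [u n] by
    [u n - w] pushes the defect to length k + 1 ([extension_step]), and by
    completeness the corrections converge to a choice without defect
    ([extension]).

    The leading part lies in the brackets of length k in the cellular chains of
    the simplex, shifted down by one, and has degree n - 2.  These brackets have
    no homology in degrees above - k ([acyclic]).  Indeed the cone contraction h
    to the vertex 0 extends to a derivation, and so does E = d h + h d, which
    maps a generator v to v, except that it maps a vertex to its difference with
    a_0.  Hence E is triangular for the number of letters other than a_0, with
    that number as eigenvalue.  A bracket of length k in degree above - k has at
    least one such letter, so E is invertible there; but E e = d h e for a cycle
    e.  For n >= 1 the degree n - 2 exceeds - k; for n = 0 the Maurer-Cartan
    equation already determines the differential ([intertwined0]).

    Finally [phi n] differs from the identity by an operator that raises bracket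
    length, so it is bijective ([unipotent_dgl_isomorphism]). *)

(** * Graded Lie brackets and the filtration by bracket length *)

Arguments bracket : simpl never.
Arguments homog : simpl never.

Section Bracket.
Variable L : gradedLie.
Implicit Types x y z : L.

Lemma bracketDl x y z : bracket (x + y) z = bracket x z + bracket y z.
Proof. by rewrite -[x]scale1r bracketPl !scale1r. Qed.

Lemma bracketDr x y z : bracket x (y + z) = bracket x y + bracket x z.
Proof. by rewrite -[y]scale1r bracketPr !scale1r. Qed.

Lemma bracket0l z : bracket 0 z = 0.
Proof. by apply: (addrI (bracket 0 z)); rewrite -bracketDl !addr0. Qed.

Lemma bracket0r z : bracket z 0 = 0.
Proof. by apply: (addrI (bracket z 0)); rewrite -bracketDr !addr0. Qed.

Lemma bracketZl a x z : bracket (a *: x) z = a *: bracket x z.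
Proof. by rewrite -[a *: x]addr0 bracketPl bracket0l addr0. Qed.

Lemma bracketBl x y z : bracket (x - y) z = bracket x z - bracket y z.
Proof. by rewrite -scaleN1r addrC bracketPl scaleN1r addrC. Qed.

Lemma bracketBr x y z : bracket x (y - z) = bracket x y - bracket x z.
Proof. by rewrite -scaleN1r addrC bracketPr scaleN1r addrC. Qed.

Lemma homogD p x y : homog p x -> homog p y -> homog p (x + y).
Proof. by move=> hx hy; rewrite -[x]scale1r; exact: homogP. Qed.

Lemma homogZ p a x : homog p x -> homog p (a *: x).
Proof. by move=> hx; rewrite -[_ *: _]addr0; apply: homogP => //; exact: homog0. Qed.

Lemma homogB p x y : homog p x -> homog p y -> homog p (x - y).
Proof. by move=> hx hy; rewrite addrC -scaleN1r; exact: homogP. Qed.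

End Bracket.

Section Filtration.
Variable X : gradedSet.
Implicit Types x y z : lhat X.

Lemma lhat_ge1 x : lhat_ge 1 x.
Proof. exact: (@lcs_lhat_ge X 0%N x I). Qed.

Lemma lhat_geP k a x y : lhat_ge k x -> lhat_ge k y -> lhat_ge k (a *: x + y).
Proof.
move=> [F oF ->] [G oG ->]; exists (a *: F + G); last by rewrite clsD clsZ.
by move=> t lt; rewrite bvalP !fctE oF // oG // scaler0 addr0.
Qed.

Lemma lhat_ge0 k : lhat_ge k (0 : lhat X).
Proof. by exists 0; rewrite ?cls0. Qed.

Lemma lhat_geD k x y : lhat_ge k x -> lhat_ge k y -> lhat_ge k (x + y).
Proof. by move=> hx hy; rewrite -[x]scale1r; exact: lhat_geP. Qed.

Lemma lhat_geZ k a x : lhat_ge k x -> lhat_ge k (a *: x).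
Proof. by move=> hx; rewrite -[_ *: _]addr0; apply: lhat_geP => //; exact: lhat_ge0. Qed.

Lemma lhat_geN k x : lhat_ge k x -> lhat_ge k (- x).
Proof. by move=> hx; rewrite -scaleN1r; exact: lhat_geZ. Qed.

Lemma lhat_geB k x y : lhat_ge k x -> lhat_ge k y -> lhat_ge k (x - y).
Proof. by move=> hx hy; apply: lhat_geD => //; exact: lhat_geN. Qed.

Lemma lhat_ge_sum k I (r : seq I) (x : I -> lhat X) :
  (forall i, lhat_ge k (x i)) -> lhat_ge k (\sum_(i <- r) x i).
Proof.
by move=> H; elim/big_rec: _ => [|i y _]; [exact: lhat_ge0 | exact: lhat_geD].
Qed.

Lemma lhat_ge_le i k x : (i <= k)%N -> lhat_ge k x -> lhat_ge i x.
Proof. by move=> le [F oF ->]; exists F => // t lt; apply: oF; exact: leq_trans le. Qed.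

Lemma lhat_ge_bracket i j x y : lhat_ge i x -> lhat_ge j y -> lhat_ge (i + j) (bracket x y).
Proof.
move=> [F oF ->] [G oG ->]; rewrite /bracket /= lhat_bracketE.
exists (bsmul F G) => // -[v|s t] //= lt.
have [l|l] := ltnP (wt s) i; first by rewrite oF ?mul0r.
by rewrite oG ?mulr0 // ltnNge; apply: contraTN lt => l'; rewrite -leqNgt leq_add.
Qed.

Lemma homog_gen v : homog (gdeg v) (gen v : lhat X).
Proof. by eexists; last reflexivity; exact: (@shom_mono X (Leaf v)). Qed.

Lemma gen_decomp x : exists (c : X -> rat) z,
  lhat_ge 2 z /\ x = \sum_v c v *: gen v + z.
Proof.
pose c v := bval (rep x) (Leaf v).
exists c, (x - \sum_v c v *: gen v); split; last by rewrite addrC subrK.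
exists (rep x - \sum_v c v *: bhom (@shom_mono X (Leaf v))); last first.
  rewrite clsB repK cls_sum; congr (_ - _).
  by apply: eq_bigr => v _; rewrite clsZ.
move=> [v|s t] lt; last by move: lt (wt_gt0 s) (wt_gt0 t) => /=; lia.
rewrite [LHS](_ : _ = c v - bval (\sum_v c v *: bhom (@shom_mono X (Leaf v))) (Leaf v)) //.
rewrite bval_sum fct_sumE (bigD1 v) //= big1.
  by rewrite !fctE /= eqxx addr0 /GRing.scale /= mulr1 subrr.
move=> w ne; rewrite !fctE /=.
rewrite (_ : (Leaf v == Leaf w) = (v == w)) // eq_sym (negPf ne).
exact: mulr0.
Qed.

End Filtration.

(** A derivation along Lie morphisms is determined up to deeper brackets by its
    values on generators: [theta] raises bracket length by as much on all
    elements as it does on generators.  The maps [alpha] and [beta] leave room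
    for derivations of a single morphism, for differences of two morphisms and
    for signs. *)
Lemma leibniz_ge (X Y : gradedSet) (theta : {linear lhat X -> lhat Y})
    (alpha : lhat X -> lhat Y) (beta : X -> lhat Y) r :
  (forall k x, lhat_ge k x -> lhat_ge k (alpha x)) ->
  (forall v, lhat_ge r.+1 (theta (gen v))) ->
  (forall v y, theta (bracket (gen v) y) =
     bracket (theta (gen v)) (alpha y) + bracket (beta v) (theta y)) ->
  forall k x, lhat_ge k.+1 x -> lhat_ge (k + r).+1 (theta x).
Proof.
move=> ha hg hb.
(* For k = 0 the depth r + 1 is reached one step at a time: [theta] of an
   infinite sum is not known to be the sum of the values, and each use of the
   Leibniz rule gains only one bracket. *)
have H m x : (m <= r)%N -> lhat_ge m.+1 (theta x).
  elim: m x => [|m IHm] x le; first exact: lhat_ge1.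
  have [c [z [hz ->]]] := gen_decomp x.
  rewrite linearD linear_sum; apply: lhat_geD.
    by apply: lhat_ge_sum => v; rewrite linearZ; apply: lhat_geZ; apply: lhat_ge_le (hg v).
  have [w [hw ->]] := lhat_ge_decomp hz.
  rewrite linear_sum; apply: lhat_ge_sum => v; rewrite hb; apply: lhat_geD.
    by apply: (@lhat_ge_le _ _ (r.+1 + 1)); [lia | exact: lhat_ge_bracket (hg v) (ha _ _ (hw v))].
  apply: (@lhat_ge_le _ _ (1 + m.+1)); first by lia.
  by apply: lhat_ge_bracket; [exact: lhat_ge1 | apply: IHm; exact: ltnW].
elim=> [|k IH] x hx; first exact: H.
have [w [hw ->]] := lhat_ge_decomp hx.
rewrite linear_sum; apply: lhat_ge_sum => v; rewrite hb; apply: lhat_geD.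
  by apply: (@lhat_ge_le _ _ (r.+1 + k.+1)); [lia | exact: lhat_ge_bracket (hg v) (ha _ _ (hw v))].
apply: (@lhat_ge_le _ _ (1 + (k + r).+1)); first by lia.
by apply: lhat_ge_bracket; [exact: lhat_ge1 | exact: IH (hw v)].
Qed.

Section Morphism.
Variables X Y : gradedSet.

Lemma lie_morphism_ge (f : {linear lhat X -> lhat Y}) : lie_morphism f ->
  forall k x, lhat_ge k x -> lhat_ge k (f x).
Proof.
move=> [_ hf] [|k] x; first by move=> _; exact: lhat_ge_le (lhat_ge1 _).
elim: k x => [|k IH] x; first by move=> _; exact: lhat_ge1.
move=> /lhat_ge_decomp [y [hy ->]]; rewrite linear_sum; apply: lhat_ge_sum => v.
by rewrite hf -add1n; apply: lhat_ge_bracket; [exact: lhat_ge1 | exact: IH].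
Qed.

(** Continuity is automatic: the difference of two such morphisms raises bracket
    length by any amount, hence vanishes. *)
Lemma lie_morphism_eq (f g : {linear lhat X -> lhat Y}) :
  lie_morphism f -> lie_morphism g -> (forall v, f (gen v) = g (gen v)) -> f =1 g.
Proof.
move=> hf hg e x; apply/eqP; rewrite -subr_eq0; apply/eqP.
apply: lhat_ge_sep => k; apply: (@lhat_ge_le _ _ (0 + k).+1); first by lia.
apply: (@leibniz_ge _ _ (f \- g) f (fun v => g (gen v)) k) (lhat_ge1 x).
- exact: lie_morphism_ge.
- by move=> v /=; rewrite e subrr; exact: lhat_ge0.
- move=> v y /=; rewrite hf.2 hg.2 bracketBl bracketBr e subrr.
  by rewrite add0r.
Qed.

End Morphism.

Lemma dgl_ge X (D : {linear lhat X -> lhat X}) : is_dgl D ->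
  forall k x, lhat_ge k x -> lhat_ge k (D x).
Proof.
move=> [_ _ hD _] [|k] x; first by move=> _; exact: lhat_ge_le (lhat_ge1 _).
move=> hx; rewrite -[k.+1]addn0 addSn.
apply: (@leibniz_ge _ _ D id (fun v => (-1) ^ gdeg v *: gen v) 0) hx => // [v|v y].
  exact: lhat_ge1.
by rewrite (hD (gdeg v)) ?bracketZl //; exact: homog_gen.
Qed.

(** * The universal property of the free complete graded Lie algebra *)

Section Substitution.
Variables (X Y : gradedSet) (y : X -> series Y).
Implicit Types (f g : series X).

(** The coefficient at t of the series obtained from f by substituting the series
    [y v] for each generator v.  A product is substituted factor by factor, which
    only needs the coefficients of a factor at proper subtrees of t; so the
    infinite sum over the monomials of f is replaced by a recursion on t. *)
Fixpoint subst (f : magma X -> rat) (t : magma Y) : rat :=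
  \sum_v f (Leaf v) * y v t +
  if t is Node a b then subst (fun a' => subst (fun b' => f (Node a' b')) b) a
  else 0.

Lemma substP (c : rat) f g t : subst (c *: f + g) t = c * subst f t + subst g t.
Proof.
elim: t f g => [w|a IHa b IHb] f g /=.
  rewrite !addr0 mulr_sumr -big_split; apply: eq_bigr => v _ /=.
  by rewrite !fctE /GRing.scale /=; ring.
rewrite [X in _ + X = _](_ : _ =
  subst (c *: ((fun a' => subst (fun b' => f (Node a' b')) b) : series X)
         + ((fun a' => subst (fun b' => g (Node a' b')) b) : series X)) a); last first.
  by congr (subst _ a); apply/funext => a'; exact: IHb.
rewrite IHa mulrDr addrACA; congr (_ + _).
rewrite mulr_sumr -big_split; apply: eq_bigr => v _ /=.
by rewrite !fctE /GRing.scale /=; ring.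
Qed.

Lemma subst0 t : subst 0 t = 0.
Proof.
have := substP 1 0 0 t; rewrite scaler0 addr0 mul1r => e.
by apply: (addrI (subst 0 t)); rewrite -e addr0.
Qed.

Lemma subst_smul f g : subst (smul f g) = smul (subst f) (subst g).
Proof.
have Z c h t : subst (fun s => c * h s) t = c * subst h t.
  by rewrite -[RHS]addr0 -(subst0 t) -substP addr0.
apply/funext => -[w|a b] /=; first by rewrite addr0 big1 // => v _; exact: mul0r.
rewrite big1 ?add0r; last by move=> v _; exact: mul0r.
rewrite [LHS](_ : _ = subst (fun a' => subst g b * f a') a); first by rewrite Z mulrC.
by congr (subst _ a); apply/funext => a'; rewrite Z mulrC.
Qed.

Lemma subst_leaf v : subst (mono (Leaf v)) = y v.
Proof.
apply/funext => t.
have e : \sum_w (mono (Leaf v) (Leaf w) : rat) * y w t = y v t.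
  rewrite (bigD1 v) //= eqxx mul1r big1 ?addr0 // => w /negPf ne.
  by rewrite (_ : (Leaf w == Leaf v) = (w == v)) // ne mul0r.
case: t e => [w|a b] e; first by rewrite -[LHS]/(_ + 0) e addr0.
rewrite -[LHS]/(_ + _) e -[RHS]addr0; congr (_ + _).
rewrite -[RHS](subst0 a); congr (subst _ a); apply/funext => a'.
exact: subst0.
Qed.

Lemma subst_wt f t : (forall s, (wt s <= wt t)%N -> f s = 0) -> subst f t = 0.
Proof.
elim: t f => [w|a IHa b IHb] f H /=.
  by rewrite addr0 big1 // => v _; rewrite H ?mul0r // wt_gt0.
rewrite big1 ?add0r; last by move=> v _; rewrite H ?mul0r // wt_gt0.
apply: IHa => a' la; apply: IHb => b' lb; apply: H => /=; exact: leq_add.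
Qed.

Lemma subst_tdeg f t : (forall v, shom (gdeg v) (y v)) ->
  (forall s, tdeg s = tdeg t -> f s = 0) -> subst f t = 0.
Proof.
move=> hy; have L (h : magma X -> rat) s : (forall u, tdeg u = tdeg s -> h u = 0) ->
    \sum_v h (Leaf v) * y v s = 0.
  move=> H; apply: big1 => v _.
  by have [e|/hy ->] := eqVneq (tdeg s) (gdeg v); rewrite ?mulr0 // H ?mul0r.
elim: t f => [w|a IHa b IHb] f H; first by rewrite /= addr0 -[LHS]/(\sum_v _) (L f (Leaf w)).
rewrite -[LHS]/(_ + _) (L f) // add0r.
by apply: IHa => a' ea; apply: IHb => b' eb; apply: H; rewrite /= ea eb.
Qed.

Hypothesis hy : forall v, shom (gdeg v) (y v).

Lemma lie_null_subst f : lie_null f -> lie_null (subst f).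
Proof.
have sD g h : (subst (g + h) : series Y) = (subst g : series Y) + subst h.
  by apply/funext => t; rewrite -[g]scale1r substP scale1r mul1r.
have sZ a g : (subst (a *: g) : series Y) = a *: (subst g : series Y).
  by apply/funext => t; rewrite -[a *: g]addr0 substP subst0 addr0.
have sN g : (subst (- g) : series Y) = - (subst g : series Y) by rewrite -!scaleN1r sZ.
have hm (t : magma X) : shom (tdeg t) (subst (mono t) : series Y).
  elim: t => [v|a IHa b IHb]; first by rewrite subst_leaf; exact: hy.
  by rewrite -[mono _]/(smul _ _) subst_smul; exact: shom_smul.
have I g : lie_ideal g -> lie_null (subst g).
  elim=> {g} [|a g h _ Ig _ Ih|t g _ Ig|t g _ Ig|s t|r s t].
  - by rewrite (_ : subst 0 = (0 : series Y)); [exact: lie_null0 | apply/funext => t; exact: subst0].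
  - by rewrite sD sZ; exact: lie_nullP.
  - by rewrite subst_smul; exact: smul_nullr.
  - by rewrite subst_smul; exact: smul_nulll.
  - rewrite sD sZ -[mono (Node s t)]/(smul _ _) -[mono (Node t s)]/(smul _ _) !subst_smul.
    exact: smul_null_anti.
  - rewrite !sD !sN sZ -[mono (Node r _)]/(smul _ (smul _ _)).
    rewrite -[mono (Node (Node r s) _)]/(smul (smul _ _) _) -[mono (Node s _)]/(smul _ (smul _ _)).
    by rewrite !subst_smul; exact: smul_null_jac.
move=> nf; apply: lie_null_closed => n; have [g Ig e] := nf n.
exists (subst g); first exact: I.
move=> t lt; apply/eqP; rewrite -subr_eq0 -[_ - _]/(((subst f : series Y) - subst g) t) -sN -sD; apply/eqP.
by apply: subst_wt => s ls; rewrite !fctE e ?subrr // (leq_trans ls).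
Qed.

Lemma bounded_subst (F : bseries X) : subst (bval F) \in @boundedb Y.
Proof.
have [N hN] := bval_bounded F; apply/asboolP; exists N => t lt.
by apply: subst_tdeg => // s e; apply: hN; rewrite e.
Qed.

Definition bsubst F : bseries Y := BSeries (bounded_subst F).

Definition lsubst (x : lhat X) : lhat Y := cls (bsubst (rep x)).

Lemma lsubstE F : lsubst (cls F) = cls (bsubst F).
Proof.
apply/clsE => /=.
have -> : (subst (bval (rep (cls F))) : series Y) - subst (bval F) = subst (bval (rep (cls F)) - bval F).
  apply/funext => t; rewrite [in RHS]addrC -[in RHS]scaleN1r substP.
  by rewrite !fctE /GRing.scale /=; ring.
by apply: lie_null_subst; exact: rep_null.
Qed.

Lemma lsubst_linear : linear lsubst.
Proof.
move=> a x z; rewrite -[x]repK -[z]repK -clsZ -clsD !lsubstE -clsZ -clsD.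
by congr cls; apply: bseries_eq; apply/funext => t; exact: substP.
Qed.

HB.instance Definition _ :=
  GRing.isLinear.Build rat (lhat X) (lhat Y) _ lsubst lsubst_linear.

Lemma lsubst_lie : lie_morphism lsubst.
Proof.
split=> [p _ [F hF ->]|x z].
  rewrite lsubstE; exists (bsubst F) => // t ne /=.
  by apply: subst_tdeg => // s e; apply: hF; rewrite e.
rewrite -[bracket x z]/(lhat_bracket x z) -[RHS]/(lhat_bracket _ _).
rewrite -[x]repK -[z]repK lhat_bracketE !lsubstE lhat_bracketE.
by congr cls; apply: bseries_eq; exact: subst_smul.
Qed.

Lemma lsubst_gen v : lsubst (gen v) = cls (bhom (@hy v)).
Proof. by rewrite lsubstE; congr cls; apply: bseries_eq; exact: subst_leaf. Qed.

End Substitution.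

Section FreeMorphism.
Variables (X Y : gradedSet) (y : X -> lhat Y).

Lemma shom_hrep v : shom (gdeg v) (hpart (gdeg v) (bval (rep (y v)))).
Proof. exact: shom_hpart. Qed.

(** Representatives of the [y v] are cut down to degree [gdeg v], so that this is
    a Lie morphism for every y; it has the prescribed values when the [y v] have
    the right degrees ([lmor_gen]). *)
Definition lmor : {linear lhat X -> lhat Y} := lsubst (@shom_hrep).

Lemma lmor_lie : lie_morphism lmor.
Proof. exact: lsubst_lie. Qed.

Lemma lmor_gen v : homog (gdeg v) (y v) -> lmor (gen v) = y v.
Proof.
move=> [F hF e]; rewrite [LHS]lsubst_gen [RHS]e; apply/clsE => /=; rewrite e.
rewrite -[in X in _ - X](hpart_id hF) addrC -scaleN1r -hpartP scaleN1r addrC.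
by apply: lie_null_hpart; exact: rep_null.
Qed.

End FreeMorphism.

(** * Derivations that preserve bracket length *)

Definition tsign (X : gradedSet) (t : magma X) : rat := (-1) ^ tdeg t.

(** The coefficient at t of the derivation of formal series that maps a generator
    v to the combination of generators with coefficients [M v].  The function
    [sg] is the sign acquired in passing a left factor: [tsign] for odd
    derivations, and 1 for even ones. *)
Fixpoint der (X : gradedSet) (sg : magma X -> rat) (M : X -> X -> rat)
    (f : magma X -> rat) (t : magma X) : rat :=
  match t with
  | Leaf w => \sum_v M v w * f (Leaf v)
  | Node a b => der sg M (fun a' => f (Node a' b)) a
                + sg a * der sg M (fun b' => f (Node a b')) b
  end.

Section Der.
Variable X : gradedSet.
Implicit Types (sg f g : magma X -> rat) (M N : X -> X -> rat) (t : magma X).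

Lemma eq_der sg M f g t : f =1 g -> der sg M f t = der sg M g t.
Proof. by move=> /funext ->. Qed.

Lemma derP sg M c f g t :
  der sg M (fun s => c * f s + g s) t = c * der sg M f t + der sg M g t.
Proof.
elim: t f g => [w|a IHa b IHb] f g /=; last by rewrite IHa IHb; ring.
by rewrite mulr_sumr -big_split; apply: eq_bigr => v _ /=; ring.
Qed.

Lemma der0 sg M t : der sg M (fun=> 0) t = 0.
Proof.
by elim: t => [w|a IHa b IHb] /=; rewrite ?IHa ?IHb ?mulr0 ?addr0 // big1 // => v _; rewrite mulr0.
Qed.

Lemma derD sg M f g t :
  der sg M (fun s => f s + g s) t = der sg M f t + der sg M g t.
Proof.
rewrite -[der sg M f t]mul1r -derP; apply: eq_der => s; by rewrite mul1r.
Qed.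

Lemma derZ sg M c f t : der sg M (fun s => c * f s) t = c * der sg M f t.
Proof.
rewrite -[RHS]addr0 -(der0 sg M t) -derP; apply: eq_der => s; by rewrite addr0.
Qed.

Lemma der_sum sg M (c : X -> rat) (f : X -> magma X -> rat) t :
  der sg M (fun s => \sum_v c v * f v s) t = \sum_v c v * der sg M (f v) t.
Proof.
elim: (index_enum X) => [|v r IH].
  by rewrite big_nil -[RHS](der0 sg M t); apply: eq_der => s; rewrite big_nil.
by rewrite big_cons -IH -derP; apply: eq_der => s; rewrite big_cons.
Qed.

Lemma der_exchange sg1 sg2 M N (f : magma X -> magma X -> rat) a b :
  der sg1 M (fun a' => der sg2 N (f a') b) a =
  der sg2 N (fun b' => der sg1 M (fun a' => f a' b') a) b.
Proof.
elim: a f => [w|a1 IH1 a2 IH2] f /=; first by rewrite der_sum.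
rewrite IH1 (IH2 (fun a' => f (Node a1 a'))) -derZ -derD.
by [].
Qed.

Lemma der_wt sg M f g t : (forall s, wt s = wt t -> f s = g s) ->
  der sg M f t = der sg M g t.
Proof.
elim: t f g => [w|a IHa b IHb] f g H /=; first by apply: eq_bigr => v _; rewrite H.
congr (_ + _ * _); [apply: IHa => s e | apply: IHb => s e]; by apply: H; rewrite /= e.
Qed.

Lemma der_tdeg sg M (r : int) f t : (forall v w, M v w != 0 -> gdeg w = gdeg v + r) ->
  (forall s, tdeg s + r = tdeg t -> f s = 0) -> der sg M f t = 0.
Proof.
move=> hM; elim: t f => [w|a IHa b IHb] f H /=.
  apply: big1 => v _; have [->|/hM e] := eqVneq (M v w) 0; first by rewrite mul0r.
  by rewrite H ?mulr0 //= e.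
rewrite IHa ?IHb ?mulr0 ?addr0 // => s e; apply: H => /=; rewrite -e.
  by rewrite addrA.
by rewrite addrAC.
Qed.

Lemma tsign_Node (a b : magma X) : tsign (Node a b) = tsign a * tsign b.
Proof. by rewrite /tsign /= expfzDr // oppr_eq0 oner_eq0. Qed.

Lemma tsign2 (a : magma X) : tsign a * tsign a = 1.
Proof. by rewrite /tsign -expfzMl mulrNN mulr1 exp1rz. Qed.

Definition odd_matrix M :=
  forall v w, M v w != 0 -> (-1) ^ gdeg v = - (-1) ^ gdeg w :> rat.

Lemma der_tsign M f t : odd_matrix M ->
  der (@tsign X) M (fun s => tsign s * f s) t = - (tsign t * der (@tsign X) M f t).
Proof.
move=> hM; elim: t f => [w|a IHa b IHb] f /=.
  rewrite mulr_sumr -sumrN; apply: eq_bigr => v _ /=.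
  have [->|/hM e] := eqVneq (M v w) 0; first by rewrite !(mul0r, mulr0) oppr0.
  by rewrite /tsign /= e; ring.
rewrite (@eq_der _ _ _ (fun a' => tsign b * (tsign a' * f (Node a' b)))); last first.
  by move=> s; rewrite tsign_Node; ring.
rewrite derZ IHa [der _ _ _ b](@eq_der _ _ _ (fun b' => tsign a * (tsign b' * f (Node a b')))); last first.
  by move=> s; rewrite tsign_Node; ring.
by rewrite derZ IHb tsign_Node; ring.
Qed.

(** The anticommutator of two odd derivations is a derivation. *)
Lemma der_anticomm M N f t : odd_matrix M -> odd_matrix N ->
  der (@tsign X) M (der (@tsign X) N f) t + der (@tsign X) N (der (@tsign X) M f) t =
  der (fun=> 1) (fun u w => \sum_v (N u v * M v w + M u v * N v w)) f t.
Proof.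
move=> hM hN; elim: t f => [w|a IHa b IHb] f /=.
  under eq_bigr do rewrite mulr_sumr.
  rewrite exchange_big /= addrC.
  under eq_bigr do rewrite mulr_sumr.
  rewrite exchange_big /= -big_split; apply: eq_bigr => u _ /=.
  rewrite -big_split mulr_suml; apply: eq_bigr => v _ /=; ring.
rewrite !derD !derZ !der_tsign // -IHa -IHb.
rewrite (der_exchange _ _ M N (fun a' b' => f (Node a' b'))).
rewrite (der_exchange _ _ N M (fun a' b' => f (Node a' b'))).
have := tsign2 a; set s := tsign a => e; ring: e.
Qed.

End Der.

Section Derivation.
Variables (X : gradedSet) (M : X -> X -> rat) (r : int).
Hypothesis hM : forall v w, M v w != 0 -> gdeg w = gdeg v + r.
Hypothesis hr : (-1) ^ r = -1 :> rat.
Implicit Types (f g : series X).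

Lemma signD (p q : int) : (-1) ^ (p + q) = (-1) ^ p * (-1) ^ q :> rat.
Proof. by rewrite expfzDr // oppr_eq0 oner_eq0. Qed.

Lemma sign2 (p : int) : (-1) ^ p * (-1) ^ p = 1 :> rat.
Proof. by rewrite -expfzMl mulrNN mulr1 exp1rz. Qed.

Lemma koszulDl (p q : int) : koszul (p + r) q = koszul p q * (-1) ^ q.
Proof. by rewrite /koszul mulrDl signD -[(-1) ^ (r * q)]exprz_exp hr. Qed.

Lemma koszulDr (p q : int) : koszul p (q + r) = koszul p q * (-1) ^ p.
Proof. by rewrite /koszul mulrDr signD [p * r]mulrC -[(-1) ^ (r * p)]exprz_exp hr. Qed.

Lemma odd_derivation_matrix : odd_matrix M.
Proof. by move=> v w /hM ->; rewrite signD hr mulrN1 opprK. Qed.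

Definition dser f : series X := der (@tsign X) M f.

Lemma dserP c f g : dser (c *: f + g) = c *: dser f + dser g.
Proof. by apply/funext => t; exact: derP. Qed.

Lemma dser0 : dser 0 = 0.
Proof. by apply/funext => t; exact: der0. Qed.

Lemma dserD f g : dser (f + g) = dser f + dser g.
Proof. by apply/funext => t; exact: derD. Qed.

Lemma dserZ c f : dser (c *: f) = c *: dser f.
Proof. by apply/funext => t; exact: derZ. Qed.

Lemma dserN f : dser (- f) = - dser f.
Proof. by rewrite -!scaleN1r dserZ. Qed.

Lemma shom_dser p f : shom p f -> shom (p + r) (dser f).
Proof.
move=> hf t ne; apply: (der_tdeg _ hM) => s e.
by apply: hf; apply: contra ne => /eqP <-; rewrite e.
Qed.

Lemma dser_smul_tsign f g :
  dser (smul f g) = smul (dser f) g + smul (fun t => tsign t * f t) (dser g).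
Proof.
apply/funext => -[w|a b].
  rewrite !fctE /= addr0 /dser /=.
  by apply: big1 => v _; rewrite mulr0.
rewrite !fctE /= /dser /=; congr (_ + _); last by rewrite derZ mulrA.
by rewrite mulrC -derZ; apply: eq_der => s; rewrite mulrC.
Qed.

(** Multiplication by the signs is the substitution of (-1)^|v| v for v. *)
Lemma lie_null_tsign f : lie_null f -> lie_null ((fun t => tsign t * f t) : series X).
Proof.
pose y (v : X) : series X := (-1) ^ gdeg v *: mono (Leaf v).
have hy v : shom (gdeg v) (y v) by apply: shomZ; exact: (@shom_mono _ (Leaf v)).
move=> /(lie_null_subst (y := y) hy); congr lie_null; apply/funext.
have L (h : magma X -> rat) w : \sum_v h (Leaf v) * y v (Leaf w) = tsign (Leaf w) * h (Leaf w).
  rewrite (bigD1 w) //= big1 => [|v ne].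
    by rewrite addr0 /y !fctE /= eqxx /GRing.scale /= mulr1 mulrC.
  rewrite /y !fctE /= (_ : (Leaf w == Leaf v) = (w == v)) // eq_sym (negPf ne).
  by rewrite scaler0 mulr0.
move=> t; elim: t f => [w|a IHa b IHb] g; first by rewrite -[LHS]/(_ + 0) L addr0.
rewrite /= big1 ?add0r; last by move=> v _; rewrite /y !fctE /= scaler0 mulr0.
by rewrite IHa IHb tsign_Node mulrA.
Qed.

Lemma dser_smul p f g : shom p f ->
  dser (smul f g) = smul (dser f) g + (-1) ^ p *: smul f (dser g).
Proof.
move=> hf; rewrite dser_smul_tsign; congr (_ + _).
apply/funext => -[w|a b]; rewrite !fctE /= ?scaler0 // /GRing.scale /= mulrA /tsign.
by have [->//|/hf ->] := eqVneq (tdeg a) p; rewrite !(mul0r, mulr0).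
Qed.

(** A derivation respects antisymmetry and the Jacobi identity: applied to a
    relation between monomials, it gives a sum of the same relations with one
    monomial replaced by its derivative. *)
Lemma lie_null_dser f : lie_null f -> lie_null (dser f).
Proof.
have hm t : shom (tdeg t) (mono t : series X) := @shom_mono X t.
have hd t : shom (tdeg t + r) (dser (mono t)) by apply: shom_dser; exact: hm.
have I g : lie_ideal g -> lie_null (dser g).
  elim=> {g} [|a g h _ Ig _ Ih|t g I0 Ig|t g I0 Ig|s t|u s t].
  - by rewrite dser0; exact: lie_null0.
  - by rewrite dserP; exact: lie_nullP.
  - rewrite (dser_smul _ (hm t)) addrC; apply: lie_nullP.
      by apply: smul_nullr.
    by apply: smul_nullr; exact: lie_null_ideal.
  - rewrite dser_smul_tsign; apply: lie_nullD; first exact: smul_nulll.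
    by apply/smul_nulll/lie_null_tsign/lie_null_ideal.
  - rewrite dserD dserZ -[mono (Node s t)]/(smul _ _) -[mono (Node t s)]/(smul _ _).
    rewrite (dser_smul _ (hm s)) (dser_smul _ (hm t)).
    have N1 := smul_null_anti (hd s) (hm t).
    have N2 := smul_null_anti (hm s) (hd t).
    have := lie_nullP ((-1) ^ tdeg s) N2 N1; congr lie_null.
    rewrite koszulDl koszulDr; have := sign2 (tdeg s).
    set sp := (-1) ^ _ => e; apply/funext => w; rewrite !fctE /GRing.scale /=.
    ring: e.
  - rewrite !dserD !dserN dserZ -[mono (Node u _)]/(smul _ (smul _ _)).
    rewrite -[mono (Node (Node u s) _)]/(smul (smul _ _) _) -[mono (Node s _)]/(smul _ (smul _ _)).
    have hus : shom (tdeg u + tdeg s) (smul (mono u) (mono s) : series X) by exact: shom_smul.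
    rewrite (dser_smul _ (hm u)) (dser_smul _ (hm s)) (dser_smul _ hus) (dser_smul _ (hm u)).
    rewrite (dser_smul _ (hm s)) (dser_smul _ (hm u)).
    have N1 := smul_null_jac (mono t) (hd u) (hm s).
    have N2 := smul_null_jac (mono t) (hm u) (hd s).
    have N3 := smul_null_jac (dser (mono t)) (hm u) (hm s).
    have := lie_nullP ((-1) ^ tdeg u) N2 (lie_nullP ((-1) ^ tdeg u * (-1) ^ tdeg s) N3 N1).
    congr lie_null.
    rewrite koszulDl koszulDr signD; have := sign2 (tdeg u).
    have P c (f1 g1 h1 : series X) : smul h1 (f1 + c *: g1) = smul h1 f1 + c *: smul h1 g1.
      by rewrite addrC smulPr addrC.
    have Q c (f1 g1 h1 : series X) : smul (f1 + c *: g1) h1 = smul f1 h1 + c *: smul g1 h1.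
      by rewrite addrC smulPl addrC.
    rewrite !P !Q.
    set sp := (-1) ^ _ => e; apply/funext => w; rewrite !fctE /GRing.scale /=.
    ring: e.
move=> nf; apply: lie_null_closed => n; have [g Ig e] := nf n.
exists (dser g); first exact: I.
by move=> t lt; apply: der_wt => s ls; apply: e; rewrite ls.
Qed.

Lemma bounded_dser (F : bseries X) : dser (bval F) \in @boundedb X.
Proof.
have [N hN] := bval_bounded F; apply/asboolP; exists (N + `|r|)%N => t lt.
by apply: (der_tdeg _ hM) => s e; apply: hN; move: lt; rewrite -e; lia.
Qed.

Definition bdser F : bseries X := BSeries (bounded_dser F).

Definition dhat (x : lhat X) : lhat X := cls (bdser (rep x)).

Lemma dhatE F : dhat (cls F) = cls (bdser F).
Proof.
apply/clsE => /=; rewrite addrC -scaleN1r -dserP scaleN1r addrC.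
by apply: lie_null_dser; exact: rep_null.
Qed.

Lemma dhat_linear : linear dhat.
Proof.
move=> a x y; rewrite -[x]repK -[y]repK -clsZ -clsD !dhatE -clsZ -clsD.
by congr cls; apply: bseries_eq; exact: dserP.
Qed.

HB.instance Definition _ :=
  GRing.isLinear.Build rat (lhat X) (lhat X) _ dhat dhat_linear.

Definition linear_dhat : {linear lhat X -> lhat X} := dhat.

Lemma dhat_bracket p x y : homog p x ->
  dhat (bracket x y) = bracket (dhat x) y + (-1) ^ p *: bracket x (dhat y).
Proof.
move=> [F hF ->]; rewrite -[y]repK /bracket /= lhat_bracketE !dhatE !lhat_bracketE.
by rewrite -clsZ -clsD; congr cls; apply: bseries_eq; exact: dser_smul.
Qed.

Lemma dhat_gen v : dhat (gen v) = \sum_w M v w *: gen w.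
Proof.
rewrite dhatE (eq_bigr (fun w => cls (M v w *: bhom (@shom_mono X (Leaf w))))); last first.
  by move=> w _; rewrite clsZ.
rewrite -cls_sum; congr cls; apply: bseries_eq; rewrite bval_sum; apply/funext => t.
rewrite fct_sumE; case: t => [w|a b].
  rewrite /= /dser /= (bigD1 v) //= [in RHS](bigD1 w) //= !big1.
  - by rewrite !addr0 -[RHS]/(M v w * (Leaf w == Leaf w)%:R) !eqxx.
  - move=> u /negPf ne; rewrite -[LHS]/(M v u * (w == u)%:R).
    by rewrite eq_sym ne mulr0.
  - by move=> u /negPf ne; rewrite (_ : (Leaf u == Leaf v) = (u == v)) // ne mulr0.
rewrite [RHS]big1; last by move=> u _; exact: mulr0.
by rewrite -[LHS]/(der _ _ _ _ + _ * der _ _ _ _) /= !der0 mulr0 addr0.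
Qed.

Lemma dhat_ge k x : lhat_ge k x -> lhat_ge k (dhat x).
Proof.
move=> [F oF ->]; rewrite dhatE; exists (bdser F) => // t lt /=.
rewrite -(der0 (@tsign X) M t); apply: der_wt => s e.
by rewrite oF // e.
Qed.

End Derivation.

(** On the associated graded of the filtration by bracket length, a differential
    is the derivation that extends its linear part. *)
Lemma linear_part_dhat (X : gradedSet) (M : X -> X -> rat) (D : {linear lhat X -> lhat X})
    (hM : forall v w, M v w != 0 -> gdeg w = gdeg v + (-1)) : is_dgl D ->
  linear_part D (fun v => \sum_w M v w *: gen w) ->
  forall k x, lhat_ge k x -> lhat_ge k.+1 (D x - dhat hM x).
Proof.
move=> [_ _ hD _] lD [|k] x hx; first exact: lhat_ge1.
have hr : (-1) ^ (-1) = -1 :> rat by [].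
have -> : k.+2 = (k + 1).+1 by rewrite addn1.
rewrite -[D x - _]/((D \- linear_dhat hM hr) x).
apply: (@leibniz_ge _ _ (D \- linear_dhat hM hr) id (fun v => (-1) ^ gdeg v *: gen v) 1) hx => [//||].
- by move=> v; rewrite /= (dhat_gen hM hr); exact: lD.
- move=> v y /=; rewrite (hD (gdeg v)); last exact: homog_gen.
  rewrite (dhat_bracket hM hr _ (homog_gen v)) bracketBl bracketBr !bracketZl.
  rewrite opprD addrACA; congr (_ + _).
Qed.

(** * Acyclicity of the brackets of length k *)

Lemma homog_ge_rep (X : gradedSet) p k (x : lhat X) : homog p x -> lhat_ge k x ->
  exists F : bseries X, [/\ shom p (bval F), forall t, (wt t < k)%N -> bval F t = 0 & x = cls F].
Proof.
move=> [G hG ->] [F oF /clsE e].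
exists (bhom (@shom_hpart X p (bval F))); split; first exact: shom_hpart.
  by move=> t lt /=; rewrite /hpart oF // if_same.
apply/clsE => /=; rewrite -(hpart_id hG) addrC -scaleN1r -hpartP scaleN1r addrC.
exact: lie_null_hpart.
Qed.

Section Acyclicity.
Variables (X : gradedSet) (M N : X -> X -> rat) (v0 : X) (b : X -> rat).
Hypothesis hM : forall v w, M v w != 0 -> gdeg w = gdeg v + (-1).
Hypothesis hN : forall v w, N v w != 0 -> gdeg w = gdeg v + 1.
Hypothesis bv0 : b v0 = 1.
Hypothesis dv0 : gdeg v0 = -1.
(* For the simplex v0 is the vertex 0 and b marks the vertices: the
   anticommutator maps a vertex to its difference with v0. *)
Hypothesis hMN : forall u w,
  \sum_v (N u v * M v w + M u v * N v w) = (u == w)%:R - b u * (w == v0)%:R.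

Fixpoint letters (t : magma X) : nat :=
  match t with Leaf v => v != v0 | Node s u => letters s + letters u end.

Lemma letters_wt t : (letters t <= wt t)%N.
Proof. by elim: t => [v|s IHs u IHu] /=; [exact: leq_b1 | exact: leq_add]. Qed.

Lemma letters0_tdeg t : letters t = 0%N -> tdeg t = - (wt t)%:Z.
Proof.
elim: t => [v|s IHs u IHu] /=; first by case: eqP => // -> _; rewrite dv0.
by move=> e; rewrite IHs ?IHu; lia.
Qed.

Let hr1 : (-1) ^ (-1) = -1 :> rat. Proof. by []. Qed.
Let hr2 : (-1) ^ 1 = -1 :> rat. Proof. by []. Qed.

Definition euler (f : series X) : series X := dser M (dser N f) + dser N (dser M f).

(** Replacing a letter by v0 lowers [letters], so on the monomials of f where
    [letters] is largest the operator [euler] is multiplication by it. *)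
Lemma euler_top f t :
  (forall s, wt s = wt t -> letters s = (letters t).+1 -> f s = 0) ->
  euler f t = (letters t)%:R * f t.
Proof.
have oM := odd_derivation_matrix hM hr1; have oN := odd_derivation_matrix hN hr2.
rewrite /euler -[LHS]/(der _ _ (der _ _ f) t + der _ _ (der _ _ f) t) der_anticomm //.
elim: t f => [w|s IHs u IHu] f H /=; last first.
  rewrite mul1r IHs => [|s' e1 e2]; last by apply: H => /=; rewrite ?e1 ?e2.
  rewrite IHu => [|u' e1 e2]; last by apply: H => /=; rewrite ?e1 ?e2 ?addnS.
  by rewrite natrD mulrDl.
under eq_bigr do rewrite hMN mulrBl.
rewrite sumrB (bigD1 w) //= eqxx mul1r big1 => [|v /negPf ->]; last exact: mul0r.
rewrite addr0; have [e|ne] := eqVneq w v0; last first.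
  rewrite big1 ?subr0 ?mul1r // => v _; by rewrite mulr0 mul0r.
rewrite e in H *; rewrite (bigD1 v0) //= big1 => [|v ne]; last first.
  by rewrite H ?mulr0 //= ne eqxx.
by rewrite bv0 mulr1 mul1r addr0 subrr mul0r.
Qed.

Variable D : {linear lhat X -> lhat X}.
Hypothesis hD : is_dgl D.
Hypothesis lD : linear_part D (fun v => \sum_w M v w *: gen w).

(** Induction on a bound j for the number of letters.  If e is closed up to longer
    brackets and has at most j + 1 letters, then (j + 1) e - E e, where E is
    [euler], is closed with at most j letters by [euler_top], while E e = d h e is
    exact.  With no letter other than v0 the
    degree would be - k. *)
Lemma acyclic_letters k m j (F : bseries X) : (0 < k)%N -> - k%:Z < m ->
  shom m (bval F) -> (forall t, (wt t < k)%N -> bval F t = 0) ->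
  (forall t, wt t = k -> (j < letters t)%N -> bval F t = 0) ->
  lhat_ge k.+1 (D (cls F)) ->
  exists w, [/\ homog (m + 1) w, lhat_ge k w & lhat_ge k.+1 (cls F - D w)].
Proof.
move=> k0 km; elim: j F => [|j IH] F hF oF lF DF.
  exists 0; split; [exact: homog0 | exact: lhat_ge0 |].
  rewrite linear0 subr0; exists F => // t; rewrite ltnS leq_eqVlt => /orP [/eqP e|]; last exact: oF.
  have [l|] := posnP (letters t); last exact: lF.
  by apply: hF; rewrite letters0_tdeg // e; apply: contraTneq km => ->; rewrite Order.POrderTheory.ltxx.
set e := cls F in DF *.
pose n := dhat hN e.
have ge_e : lhat_ge k e by exists F.
have ge_n : lhat_ge k n by exact: dhat_ge.
have hn : homog (m + 1) n.
  by rewrite /n /e (dhatE hN hr2); eexists; last reflexivity; exact: (shom_dser hN).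
have hE : shom m (euler (bval F)).
  apply: shomD.
    by rewrite -[m](addrK 1); apply: (shom_dser hM); exact: (shom_dser hN).
  by rewrite -[m](subrK 1); apply: (shom_dser hN); exact: (shom_dser hM).
have eE : cls (bhom hE) = dhat hM n + dhat hN (dhat hM e).
  rewrite /n /e (dhatE hN hr2) !(dhatE hM hr1) (dhatE hN hr2) -clsD.
  by congr cls; apply: bseries_eq.
have dM x : lhat_ge k x -> lhat_ge k.+1 (D x - dhat hM x) by exact: linear_part_dhat.
have dMe : lhat_ge k.+1 (dhat hN (dhat hM e)).
  apply: (dhat_ge hN hr2).
  by rewrite -[dhat hM e](subKr (D e)); apply: lhat_geB => //; exact: dM.
(* G represents (j + 1) e - E e. *)
pose G := j.+1%:R *: F - bhom hE.
have geG : lhat_ge k.+1 (cls G - (j.+1%:R *: e - D n)).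
  rewrite /G clsB clsZ eE -/e opprB addrC addrA subrK opprD addrA.
  by apply: lhat_geB => //; exact: dM.
have DG : lhat_ge k.+1 (D (cls G)).
  have -> : D (cls G) = D (cls G - (j.+1%:R *: e - D n)) + j.+1%:R *: D e.
    have [_ _ _ DD] := hD.
    by rewrite [D (_ - (_ - _))]linearB /= [D (_ - D n)]linearB /= DD linearZ subr0 subrK.
  by apply: lhat_geD; [exact: dgl_ge | exact: lhat_geZ].
have [|||w' [hw' gw' ew']] := IH G _ _ _ DG.
- have := shomP j.+1%:R hF (shomN hE); exact.
- move=> t lt; rewrite -[LHS]/(j.+1%:R * bval F t - euler (bval F) t).
  rewrite oF // mulr0 sub0r; apply/eqP; rewrite oppr_eq0; apply/eqP.
  rewrite euler_top ?oF ?mulr0 // => s es _; by rewrite oF // es.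
- move=> t et lt; rewrite -[LHS]/(j.+1%:R * bval F t - euler (bval F) t).
  rewrite euler_top => [|s es ls]; last by apply: lF; [rewrite es | rewrite ls].
  have [l|l] := ltnP j.+1 (letters t); first by rewrite lF // !mulr0 subrr.
  by rewrite (_ : letters t = j.+1) ?subrr //; apply/eqP; rewrite eqn_leq l lt.
exists (j.+1%:R^-1 *: (n + w')); split.
- by apply: homogZ; exact: homogD.
- by apply: lhat_geZ; exact: lhat_geD.
have := lhat_geZ j.+1%:R^-1 (lhat_geB ew' geG); congr lhat_ge.
have E (A B C : lhat X) : (A - B) - (A - C) = C - B by rewrite opprB addrC addrA subrK.
by rewrite E -addrA -opprD scalerBr scalerA mulVf ?pnatr_eq0 // scale1r -linearD -linearZ.
Qed.

Lemma acyclic k m e : (0 < k)%N -> - k%:Z < m ->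
  homog m e -> lhat_ge k e -> lhat_ge k.+1 (D e) ->
  exists w, [/\ homog (m + 1) w, lhat_ge k w & lhat_ge k.+1 (e - D w)].
Proof.
move=> k0 km he ge_e De; have [F [hF oF eF]] := homog_ge_rep he ge_e.
rewrite eF in De *; apply: (@acyclic_letters k m k F) => // t <-.
by rewrite ltnNge letters_wt.
Qed.

End Acyclicity.

(** * The chains of the simplex *)

Section SimplexMatrices.
Variable n : nat.
Implicit Types (A B U W : {set 'I_n.+1}) (v w : simplex n).

Definition face_sign A (k : 'I_n.+1) : rat := (-1) ^+ #|[set j in A | (j < k)%N]|.

Definition dcoef A B : rat := \sum_(k in A) face_sign A k * (A :\ k == B)%:R.

(** The matrix of the contraction onto the vertex 0: a_A is sent to a_(0A) when 0
    is not in A, and to 0 otherwise. *)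
Definition cone A B : rat := if ord0 \in A then 0 else ((ord0 |: A) == B)%:R.

Lemma gdeg_simplex v : gdeg v = #|val v|%:Z - 2.
Proof. by []. Qed.

(** Sums over faces become sums over arbitrary sets, where the empty set stands
    for the generator 0. *)
Lemma sum_face A (g : {set 'I_n.+1} -> rat) :
  \sum_(v : simplex n) (A == val v)%:R * g (val v) = (A != set0)%:R * g A.
Proof.
have [e|ne] := eqVneq A set0.
  rewrite mul0r big1 // => v _; have [a|] := eqVneq A (val v); last by rewrite mul0r.
  by have := valP v; rewrite -a e eqxx.
rewrite (bigD1 (exist _ A ne : simplex n)) //= eqxx big1 ?addr0 // => v nv.
have [a|] := eqVneq A (val v); last by rewrite mul0r.
by case/eqP: nv; apply: val_inj.
Qed.

Lemma agenE A : agen A = \sum_(v : simplex n) (A == val v)%:R *: gen v :> LDelta n.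
Proof.
rewrite /agen; case: insubP => [s _ <-|].
  rewrite (bigD1 s) //= eqxx scale1r big1 ?addr0 // => v ne.
  have [a|] := eqVneq (val s) (val v); last by rewrite scale0r.
  by case/eqP: ne; apply: val_inj.
rewrite negbK => /eqP ->; rewrite big1 // => v _.
by rewrite eq_sym (negPf (valP v)) scale0r.
Qed.

Lemma dDeltaE v : dDelta (val v) = \sum_(w : simplex n) dcoef (val v) (val w) *: gen w.
Proof.
rewrite /dDelta; under eq_bigr do rewrite agenE scaler_sumr.
rewrite exchange_big /=; apply: eq_bigr => w _.
by rewrite scaler_suml; apply: eq_bigr => k _; rewrite scalerA.
Qed.

Lemma dcoef_deg v w : dcoef (val v) (val w) != 0 -> gdeg w = gdeg v + (-1).
Proof.
have [k /andP [ka /eqP e] _|no] := pickP (fun k => (k \in val v) && (val v :\ k == val w)).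
  by rewrite !gdeg_simplex -e [in RHS](cardsD1 k) ka; lia.
rewrite /dcoef big1 ?eqxx // => k ka; have := no k; rewrite ka /= => ->.
exact: mulr0.
Qed.

Lemma cone_deg v w : cone (val v) (val w) != 0 -> gdeg w = gdeg v + 1.
Proof.
rewrite /cone; case: ifPn; rewrite ?eqxx // => n0.
have [e _|] := eqVneq (ord0 |: val v) (val w); last by rewrite eqxx.
by rewrite !gdeg_simplex -e cardsU1 n0; lia.
Qed.

(** The cone is a homotopy from the identity to the projection that sends every
    vertex to a_0 and the other faces to 0. *)
Lemma cone_homotopy U W : U != set0 ->
  \sum_(v : simplex n) (cone U (val v) * dcoef (val v) W + dcoef U (val v) * cone (val v) W) =
  (U == W)%:R - (#|U| == 1%N)%:R * (W == [set ord0])%:R.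
Proof.
move=> U0; rewrite big_split /=.
have -> : \sum_(v : simplex n) dcoef U (val v) * cone (val v) W =
    \sum_(k in U) face_sign U k * ((U :\ k != set0)%:R * cone (U :\ k) W).
  under eq_bigr do rewrite mulr_suml.
  rewrite exchange_big; apply: eq_bigr => k _ /=.
  by rewrite -(sum_face _ (cone^~ W)) mulr_sumr; apply: eq_bigr => v _; rewrite mulrA.
rewrite /cone; have [zU|zU] := boolP (ord0 \in U).
  rewrite big1 ?add0r; last by move=> v _; rewrite mul0r.
  rewrite (bigD1 ord0) //= big1 ?addr0 => [|k /andP [_ ne]]; last first.
    by rewrite !inE zU (eq_sym ord0) ne /= !mulr0.
  rewrite !inE eqxx /= setD1K // /face_sign (_ : [set j in U | _] = set0); last first.
    by apply/setP => j; rewrite !inE ltn0 andbF.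
  rewrite cards0 expr0 mul1r.
  have -> : (U :\ ord0 != set0) = (#|U| != 1%N).
    by rewrite -cards_eq0 [in RHS](cardsD1 ord0) zU.
  case: cards1P => [[k e]|_]; last by rewrite mul1r mul0r subr0.
  move: zU; rewrite e inE => /eqP <-.
  by rewrite mul0r mul1r eq_sym subrr.
rewrite (sum_face (ord0 |: U) (dcoef^~ W)) (_ : ord0 |: U != set0); last first.
  by apply/set0Pn; exists ord0; rewrite setU11.
rewrite mul1r /dcoef big_setU1 //= setU1K //.
have -> : face_sign (ord0 |: U) ord0 = 1.
  rewrite /face_sign (_ : [set j in _ | _] = set0) ?cards0 //.
  by apply/setP => j; rewrite !inE ltn0 andbF.
rewrite mul1r -addrA -big_split /=; congr (_ + _).
have S k : k \in U -> face_sign (ord0 |: U) k = - face_sign U k.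
  move=> kU; have k0 : (0 < k)%N.
    by rewrite lt0n; apply: contraNneq zU => e; rewrite (_ : ord0 = k) //; apply: val_inj.
  rewrite /face_sign (_ : [set j in ord0 |: U | _] = ord0 |: [set j in U | (j < k)%N]); last first.
    by apply/setP => j; rewrite !inE; case: eqP => //= ->; rewrite k0.
  by rewrite cardsU1 inE (negPf zU) /= exprS mulN1r.
have R k : k \in U -> (ord0 |: U) :\ k = ord0 |: (U :\ k).
  move=> kU; rewrite setDUl; congr (_ :|: _); apply/setP => j; rewrite !inE andbC.
  by case: eqP => // ->; apply: contraNneq zU => ->.
have [/cards1P [k e]|c1] := boolP (#|U| == 1%N).
  have kU : k \in U by rewrite e set11.
  have Uk : U :\ k = set0 by apply/setP => j; rewrite e !inE andNb.
  rewrite (big_pred1 k) /= => [|i]; last by rewrite e inE.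
  rewrite S // R // Uk eqxx mul0r mulr0 addr0 setU0 mul1r mulNr [W == _]eq_sym.
  rewrite (_ : face_sign _ _ = 1) ?mul1r // /face_sign (_ : [set j in _ | _] = set0) ?cards0 //.
  by apply/setP => j; rewrite e !inE; case: eqP => // ->; rewrite ltnn.
rewrite mul0r oppr0 big1 // => k kU; rewrite S // R //.
rewrite !inE (negPf zU) andbF -cards_eq0.
have -> : #|U :\ k| != 0%N by move: c1; rewrite [#|U|](cardsD1 k) kU.
by rewrite mul1r mulNr addNr.
Qed.

Lemma simplex_acyclic (D : {linear LDelta n -> LDelta n}) k (m : int) e :
  is_dgl D -> linear_part D (fun A : simplex n => dDelta (val A)) ->
  (0 < k)%N -> - k%:Z < m ->
  homog m e -> lhat_ge k e -> lhat_ge k.+1 (D e) ->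
  exists x, [/\ homog (m + 1) x, lhat_ge k x & lhat_ge k.+1 (e - D x)].
Proof.
move=> hD lD.
have z0 : [set ord0 : 'I_n.+1] != set0 by rewrite -cards_eq0 cards1.
pose v0 : simplex n := exist _ [set ord0] z0.
apply: (@acyclic _ (fun v w => dcoef (val v) (val w)) (fun v w => cone (val v) (val w))
   v0 (fun v => (#|val v| == 1%N)%:R)) => //.
- exact: dcoef_deg.
- exact: cone_deg.
- by rewrite /= cards1.
- by rewrite /= cards1.
- by move=> u w; rewrite (cone_homotopy _ (valP u)).
- by move=> v; rewrite -dDeltaE; exact: lD.
Qed.

End SimplexMatrices.

(** * The extension step *)

Definition defect (X : gradedSet) (D D' phi : {linear lhat X -> lhat X}) :
  {linear lhat X -> lhat X} := (D' \o phi) \- (phi \o D).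

Section Defect.
Variables (X : gradedSet) (D D' phi : {linear lhat X -> lhat X}).
Hypotheses (hD : is_dgl D) (hD' : is_dgl D') (hphi : lie_morphism phi).
Local Notation theta := (defect D D' phi).

Lemma defectE x : theta x = D' (phi x) - phi (D x). Proof. by []. Qed.

(** The differentials are derivations, so the defect is a derivation along phi. *)
Lemma defect_bracket v y : theta (bracket (gen v) y) =
  bracket (theta (gen v)) (phi y) + bracket ((-1) ^ gdeg v *: phi (gen v)) (theta y).
Proof.
have [_ _ dD _] := hD; have [_ _ dD' _] := hD'; have [hp mp] := hphi.
have hg := homog_gen v.
rewrite !defectE mp (dD' _ _ _ (hp _ _ hg)) (dD _ _ _ hg) linearD linearZ /= !mp.
by rewrite bracketBl bracketBr !bracketZl opprD addrACA.
Qed.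

Lemma defect_ge r : (forall v, lhat_ge r.+1 (theta (gen v))) ->
  forall k x, lhat_ge k.+1 x -> lhat_ge (k + r).+1 (theta x).
Proof. by move=> H; apply: leibniz_ge H defect_bracket; exact: lie_morphism_ge. Qed.

Lemma defect_homog p x : homog p x -> homog (p - 1) (theta x).
Proof.
have [_ hd _ _] := hD; have [_ hd' _ _] := hD'; have [hp mp] := hphi.
by move=> hx; rewrite defectE; apply: homogB; [apply: hd' | apply: hp]; auto.
Qed.

Lemma defect_diff x : D' (theta x) = - theta (D x).
Proof.
have [_ _ _ DD] := hD; have [_ _ _ DD'] := hD'.
by rewrite !defectE linearB /= DD DD' linear0 sub0r subr0.
Qed.

Lemma defect_gen_eq0 : (forall v, theta (gen v) = 0) -> forall x, phi (D x) = D' (phi x).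
Proof.
move=> H x; apply/esym/eqP; rewrite -subr_eq0 -defectE; apply/eqP/lhat_ge_sep => k.
apply: (@lhat_ge_le _ _ (0 + k).+1); first by lia.
by apply: defect_ge (lhat_ge1 x) => v; rewrite H; exact: lhat_ge0.
Qed.

End Defect.

Section Extension.
Variables (X : gradedSet) (T : X) (D D' : {linear lhat X -> lhat X}).
Variables (y : X -> lhat X) (c : X -> rat).
Hypotheses (hD : is_dgl D) (hD' : is_dgl D').
Hypothesis hy : forall v, homog (gdeg v) (y v).
Hypothesis gy : forall v, lhat_ge 2 (y v - gen v).
Hypothesis cT : c T = 0.
Hypothesis lD : lhat_ge 2 (D (gen T) - \sum_v c v *: gen v).
Hypothesis lD' : lhat_ge 2 (D' (gen T) - \sum_v c v *: gen v).

Definition setval (u : lhat X) v := if v == T then u else y v.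
Local Notation phi u := (lmor (setval u)).
Local Notation theta u := (defect D D' (phi u)).

Hypothesis theta0 : forall u v, v != T -> homog (gdeg T) u -> theta u (gen v) = 0.
Hypothesis acyc : forall k e, (1 < k)%N -> homog (gdeg T - 1) e -> lhat_ge k e ->
  lhat_ge k.+1 (D' e) ->
  exists w, [/\ homog (gdeg T) w, lhat_ge k w & lhat_ge k.+1 (e - D' w)].

Lemma setval_gen u v : homog (gdeg T) u -> phi u (gen v) = setval u v.
Proof. by move=> hu; apply: lmor_gen; rewrite /setval; case: eqP => [->|]. Qed.

(** D T involves T only inside brackets of length at least 2, so changing the
    value at T by brackets of length k + 1 changes the image of D T by longer
    ones. *)
Lemma lmor_setval_ge u u' k : homog (gdeg T) u -> homog (gdeg T) u' ->
  lhat_ge k.+1 (u' - u) -> lhat_ge k.+2 (phi u' (D (gen T)) - phi u (D (gen T))).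
Proof.
move=> hu hu' ge_u; pose f : {linear lhat X -> lhat X} := phi u' \- phi u.
rewrite -[D (gen T)](subrK (\sum_v c v *: gen v)) -[X in lhat_ge _ X]/(f (_ + _)) linearD.
apply: lhat_geD.
  have m1 := lmor_lie (setval u); have m2 := lmor_lie (setval u').
  apply: (@leibniz_ge _ _ f (phi u') (fun v => phi u (gen v)) k _ _ _ 1) lD.
  - exact: lie_morphism_ge.
  - move=> v; rewrite /f /= !setval_gen // /setval.
    by case: eqP => // _; rewrite subrr; exact: lhat_ge0.
  - move=> v x; rewrite /f /= m1.2 m2.2 bracketBl bracketBr.
    by rewrite addrA subrK.
rewrite linear_sum; apply: lhat_ge_sum => v; rewrite linearZ /f /= !setval_gen // /setval.
by case: eqP => [->|_]; rewrite ?cT ?scale0r ?subrr ?scaler0; exact: lhat_ge0.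
Qed.

(** The defect at T is closed to first order, because the defect vanishes on the
    linear part of D T; subtracting a primitive from the value at T cancels its
    leading part. *)
Lemma extension_step k u : (1 < k)%N -> homog (gdeg T) u ->
  lhat_ge k (theta u (gen T)) -> exists u',
  [/\ homog (gdeg T) u', lhat_ge k (u' - u) & lhat_ge k.+1 (theta u' (gen T))].
Proof.
case: k => // k k1 hu ge_e; set e := theta u (gen T) in ge_e.
have ge_v v : lhat_ge k.+1 (theta u (gen v)).
  by have [->//|ne] := eqVneq v T; rewrite theta0 //; exact: lhat_ge0.
have De : lhat_ge k.+2 (D' e).
  rewrite (defect_diff _ hD hD'); apply: lhat_geN.
  rewrite -[D (gen T)](subrK (\sum_v c v *: gen v)) linearD; apply: lhat_geD.
    exact: (defect_ge hD hD' (@lmor_lie _ _ _) ge_v lD).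
  rewrite linear_sum; apply: lhat_ge_sum => v; rewrite linearZZ.
  have [->|ne] := eqVneq v T; first by rewrite cT scale0r; exact: lhat_ge0.
  by rewrite theta0 // scaler0; exact: lhat_ge0.
have he : homog (gdeg T - 1) e.
  by apply: (defect_homog hD hD' (@lmor_lie _ _ _)); exact: homog_gen.
have [w [hw gw ew]] := acyc k1 he ge_e De.
have hu' : homog (gdeg T) (u - w) by exact: homogB.
have gu : lhat_ge k.+1 (u - w - u) by rewrite addrAC subrr sub0r; exact: lhat_geN.
exists (u - w); split => //.
have := lhat_geB ew (lmor_setval_ge hu hu' gu); congr lhat_ge.
have E (a b p q : lhat X) : (a - p - b) - (q - p) = a - b - q.
  by rewrite opprB [a - p - b]addrAC addrA subrK.
by rewrite /e !defectE !setval_gen // /setval eqxx E linearB.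
Qed.

Lemma extension : exists u, [/\ homog (gdeg T) u, lhat_ge 2 (u - gen T)
  & theta u (gen T) = 0].
Proof.
have /choice [f hf] : forall p : nat * lhat X, exists u', homog (gdeg T) p.2 ->
    lhat_ge p.1.+2 (theta p.2 (gen T)) ->
    [/\ homog (gdeg T) u', lhat_ge p.1.+2 (u' - p.2) & lhat_ge p.1.+3 (theta u' (gen T))].
  move=> [k u] /=; have [[h g]|no] := pselect (homog (gdeg T) u /\ lhat_ge k.+2 (theta u (gen T))).
    by have [u' H] := extension_step (k := k.+2) isT h g; exists u'.
  by exists 0 => h g; case: no.
pose u := fix u k : lhat X := if k is k'.+1 then f (k', u k') else gen T.
have hg : homog (gdeg T) (gen T : lhat X) by exact: homog_gen.
have Hu k : homog (gdeg T) (u k) /\ lhat_ge k.+2 (theta (u k) (gen T)).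
  elim: k => [|k [h g]]; last by have [] := hf (k, u k) h g.
  split=> //; rewrite defectE setval_gen // {1}/setval eqxx.
  pose d : lhat X := \sum_v c v *: gen v.
  have gD : lhat_ge 2 (D (gen T) - d) := lD.
  have gD' : lhat_ge 2 (D' (gen T) - d) := lD'.
  have gd : lhat_ge 2 (phi (u 0%N) d - d).
    rewrite /d linear_sum -sumrB; apply: lhat_ge_sum => v.
    rewrite linearZ -scalerBr; apply: lhat_geZ; rewrite setval_gen // /setval.
    by case: eqP => [->|_]; [rewrite subrr; exact: lhat_ge0 | exact: gy].
  rewrite -[D' _](subrK d) -[D (gen T)](subrK d) linearD /=.
  rewrite (_ : forall a b b' : lhat X, a + d - (b + b') = a - b - (b' - d)); last first.
    by move=> a b b'; rewrite opprB opprD !addrA [a + d - b]addrAC addrAC.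
  by apply/lhat_geB => //; apply: lhat_geB => //; apply: lie_morphism_ge gD; exact: lmor_lie.
have gu k : lhat_ge k.+2 (u k.+1 - u k).
  by have [h g] := Hu k; have [] := hf (k, u k) h g.
have [_ /(_ u) []] := @lhat_complete X (gdeg T).
- by move=> k; have [] := Hu k.
- by move=> k; apply: lhat_ge_lcs; apply: lhat_ge_le (gu k).
move=> w [hw /= gw]; have {}gw k : lhat_ge k.+1 (w - u k) by exact: lcs_lhat_ge.
exists w; split=> //.
  by rewrite -(subrK (u 1%N) w) -addrA; apply: lhat_geD; [exact: gw | exact: (gu 0%N)].
apply: (@lhat_ge_sep _ (theta w (gen T))) => k.
have [huk guk] := Hu k.
have E (a b p q : lhat X) : a - q = (b - p) + (a - b) - (q - p).
  by rewrite opprB [b - p + _]addrC !addrA !subrK.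
rewrite defectE setval_gen // {1}/setval eqxx.
rewrite (E _ (D' (u k)) (phi (u k) (D (gen T)))) -linearB.
apply: lhat_geB; first apply: lhat_geD.
- by move: guk; rewrite defectE setval_gen // {1}/setval eqxx; apply: lhat_ge_le; lia.
- by apply: (dgl_ge hD'); exact: lhat_ge_le (leqnSn k) (gw k).
- by apply: lhat_ge_le (lmor_setval_ge huk hw (gw k)); lia.
Qed.

End Extension.

(** * Morphisms that are the identity to first order *)

Section Isomorphism.
Variables (X : gradedSet) (D D' phi : {linear lhat X -> lhat X}).
Hypothesis hphi : lie_morphism phi.
Hypothesis phi2 : forall v, lhat_ge 2 (phi (gen v) - gen v).
Hypothesis phiD : forall x, phi (D x) = D' (phi x).

Lemma unipotent_ge k x : lhat_ge k.+1 x -> lhat_ge k.+2 (phi x - x).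
Proof.
pose f : {linear lhat X -> lhat X} := phi \- idfun.
move=> hx; rewrite -[X in lhat_ge _ X]/(f x) -[k.+2]/(1 + k).+1 addnC.
apply: (@leibniz_ge _ _ f phi (fun v => gen v) 1) hx => //; first exact: lie_morphism_ge.
move=> v y; rewrite /f /= hphi.2 bracketBl bracketBr.
by rewrite addrA subrK.
Qed.

Lemma unipotent_inj : injective phi.
Proof.
move=> x y e; apply/eqP; rewrite -subr_eq0; apply/eqP; set z := x - y.
have z0 : phi z = 0 by rewrite linearB e subrr.
suff H k : lhat_ge k.+1 z by apply: lhat_ge_sep => k; apply: lhat_ge_le (H k).
elim: k => [|k IH]; first exact: lhat_ge1.
by have := lhat_geN (unipotent_ge IH); rewrite z0 sub0r opprK.
Qed.

(** The equation phi x = y is solved by the iteration x <- x + (y - phi x), which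
    converges by completeness; this requires y to be homogeneous. *)
Lemma unipotent_surj_homog p y : homog p y -> exists2 x, homog p x & phi x = y.
Proof.
move=> hy; have [hp _] := hphi.
pose u := fix u k : lhat X := if k is k'.+1 then u k' + (y - phi (u k')) else 0.
have hu k : homog p (u k).
  elim: k => [|k IH]; first exact: homog0.
  by apply: homogD => //; apply: homogB => //; exact: hp.
have gu k : lhat_ge k.+1 (y - phi (u k)).
  elim: k => [|k IH]; first exact: lhat_ge1.
  have := lhat_geN (unipotent_ge IH); rewrite opprB /=; set r := y - phi (u k).
  by rewrite [phi (_ + r)]linearD opprD addrA.
have [_ /(_ u hu) []] := @lhat_complete X p.
  by move=> k; rewrite /= addrC addKr; apply: lhat_ge_lcs; exact: gu.
move=> x [hx gx]; exists x => //; apply/esym/eqP; rewrite -subr_eq0; apply/eqP.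
apply: lhat_ge_sep => k; apply: (@lhat_ge_le _ _ k.+1) => //.
rewrite (_ : y - phi x = (y - phi (u k)) - phi (x - u k)); last first.
  by rewrite linearB opprB addrA subrK.
by apply: lhat_geB => //; apply: lie_morphism_ge => //; exact: lcs_lhat_ge.
Qed.

Lemma unipotent_surj y : exists x, phi x = y.
Proof.
have [s [c [hc ->]]] := homog_sum y.
have /choice [x hx] : forall p, exists x, phi x = c p.
  by move=> p; have [x _ e] := unipotent_surj_homog (hc p); exists x.
by exists (\sum_(p <- s) x p); rewrite linear_sum; apply: eq_bigr => p _.
Qed.

Lemma unipotent_dgl_isomorphism : dgl_isomorphism D D' phi.
Proof.
split=> //; have [g gK] := choice unipotent_surj.
have Kg : cancel phi g by move=> x; apply: unipotent_inj; rewrite gK.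
have gl : linear g by move=> a x y; apply: unipotent_inj; rewrite linearP !gK.
pose G : {linear lhat X -> lhat X} := HB.pack g (GRing.isLinear.Build rat _ _ _ g gl).
exists G; split=> //; split=> [|x]; last by apply: unipotent_inj; rewrite phiD !gK.
split=> [p y hy|x y]; last by apply: unipotent_inj; rewrite hphi.2 !gK.
by have [x hx <-] := unipotent_surj_homog hy; rewrite /= Kg.
Qed.

End Isomorphism.

(** * Face maps *)

Record incr_map (p n : nat) := IncrMap {
  incr_fun :> 'I_p.+1 -> 'I_n.+1;
  incr_lt : forall i j : 'I_p.+1, (i < j)%N -> (incr_fun i < incr_fun j)%N }.

Lemma incr_inj p n (f : incr_map p n) : injective f.
Proof.
move=> i j e; apply: val_inj; case: (ltngtP i j) => // /(incr_lt f); by rewrite e ltnn.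
Qed.

Lemma sorted_incr_map p n (f : incr_map p n) :
  sorted ltn [seq val (f i) | i <- enum 'I_p.+1].
Proof.
apply: (homo_sorted (e := fun i j : 'I_p.+1 => (i < j)%N)); first exact: incr_lt.
by have := iota_ltn_sorted 0 p.+1; rewrite -val_enum_ord sorted_map.
Qed.

Lemma incr_map_eq p n (f g : incr_map p n) : f @: [set: _] = g @: [set: _] -> f =1 g.
Proof.
move=> e; have: [seq val (f i) | i <- enum 'I_p.+1] = [seq val (g i) | i <- enum 'I_p.+1].
  apply: (irr_sorted_eq ltn_trans ltnn); try exact: sorted_incr_map.
  have H (h k : incr_map p n) x : h @: [set: _] = k @: [set: _] ->
      x \in [seq val (h i) | i <- enum 'I_p.+1] -> x \in [seq val (k i) | i <- enum 'I_p.+1].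
    move=> hk /mapP [i _ ->]; have : h i \in h @: [set: _] by apply: imset_f; rewrite inE.
    rewrite hk => /imsetP [j _ ->]; apply/mapP; exists j => //; exact: mem_enum.
  by move=> x; apply/idP/idP; apply: H.
by move/eq_in_map => H i; apply: val_inj; apply: H; rewrite mem_enum.
Qed.

Definition incr_comp p m n (g : incr_map m n) (f : incr_map p m) : incr_map p n :=
  IncrMap (fun i j ij => incr_lt g (incr_lt f ij)).

Definition incr_id n : incr_map n n := @IncrMap n n id (fun i j ij => ij).

Lemma lift_lt n (i : 'I_n.+2) (j k : 'I_n.+1) : (j < k)%N = (lift i j < lift i k)%N.
Proof. by rewrite /= /bump; case: (leqP i j); case: (leqP i k); lia. Qed.

Definition incr_lift n (i : 'I_n.+2) : incr_map n n.+1 :=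
  @IncrMap n n.+1 (lift i) (fun j k jk => etrans (esym (lift_lt i j k)) jk).

Section Enumeration.
Variables (n : nat) (A : simplex n).

Lemma card_simplex : #|val A| = #|val A|.-1.+1.
Proof. by rewrite prednK // card_gt0 (valP A). Qed.

Lemma enum_incr (i j : 'I_#|val A|.-1.+1) : (i < j)%N ->
  (nth ord0 (enum (val A)) i < nth ord0 (enum (val A)) j)%N.
Proof.
move=> ij; have s : sorted (fun i j : 'I_n.+1 => (i < j)%N) (enum (val A)).
  rewrite /enum_mem; apply: sorted_filter; first by move=> x y z; exact: ltn_trans.
  by have := iota_ltn_sorted 0 n.+1; rewrite -val_enum_ord sorted_map enumT.
apply: (sorted_ltn_nth _ _ s) => //; first by move=> x y z; exact: ltn_trans.
- by rewrite inE -cardE [X in (_ < X)%N]card_simplex.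
- by rewrite inE -cardE [X in (_ < X)%N]card_simplex.
Qed.

Definition enum_map : incr_map #|val A|.-1 n := IncrMap enum_incr.

Lemma enum_map_image : enum_map @: [set: _] = val A.
Proof.
apply/setP => x; apply/imsetP/idP => [[i _ ->]|xA] /=.
  by rewrite -mem_enum mem_nth // -cardE [X in (_ < X)%N]card_simplex.
have lt : (index x (enum (val A)) < #|val A|.-1.+1)%N.
  by rewrite -card_simplex cardE index_mem mem_enum.
by exists (Ordinal lt) => //=; rewrite nth_index // mem_enum.
Qed.

End Enumeration.

Lemma image_neq0 p n (f : incr_map p n) (A : simplex p) : f @: val A != set0.
Proof. by rewrite imset_eq0 (valP A). Qed.

Definition image_face p n (f : incr_map p n) (A : simplex p) : simplex n :=
  exist (fun B : {set 'I_n.+1} => B != set0) (f @: val A) (image_neq0 f A).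

Lemma gdeg_image_face p n (f : incr_map p n) (A : simplex p) :
  gdeg (image_face f A) = gdeg A.
Proof. by rewrite !gdeg_simplex /= card_imset //; exact: incr_inj. Qed.

Definition face_map p n (f : incr_map p n) : {linear LDelta p -> LDelta n} :=
  lhat_map (GradedMap (gdeg_image_face f)).

Lemma face_map_lie p n (f : incr_map p n) : lie_morphism (face_map f).
Proof. exact: lhat_map_lie. Qed.

Lemma face_map_gen p n (f : incr_map p n) A : face_map f (gen A) = gen (image_face f A).
Proof. exact: lhat_map_gen. Qed.

Lemma eq_face_map p n (f g : incr_map p n) : f =1 g -> face_map f =1 face_map g.
Proof.
move=> e; apply: lie_morphism_eq; try exact: face_map_lie.
by move=> A; rewrite !face_map_gen; congr gen; apply: val_inj; exact: eq_imset.
Qed.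

Lemma lie_morphism_comp (X Y Z : gradedSet) (g : {linear lhat Y -> lhat Z})
    (f : {linear lhat X -> lhat Y}) :
  lie_morphism g -> lie_morphism f -> lie_morphism (g \o f).
Proof.
move=> [hg mg] [hf mf]; split=> [p x hx|x y] /=; first by apply/hg/hf.
by rewrite mf mg.
Qed.

Lemma face_map_comp p m n (g : incr_map m n) (f : incr_map p m) x :
  face_map g (face_map f x) = face_map (incr_comp g f) x.
Proof.
move: x; apply: (@lie_morphism_eq _ _ (face_map g \o face_map f)); last first.
- by move=> A; rewrite /= !face_map_gen; congr gen; apply: val_inj; rewrite /= -imset_comp.
- exact: face_map_lie.
- by apply: lie_morphism_comp; exact: face_map_lie.
Qed.

Lemma face_map_id n x : face_map (incr_id n) x = x.
Proof.
apply: (@lie_morphism_eq _ _ (face_map (incr_id n)) idfun) => //; first exact: face_map_lie.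
by move=> A; rewrite face_map_gen; congr gen; apply: val_inj; exact: imset_id.
Qed.

Lemma coface_face_map n (i : 'I_n.+2) : coface i =1 face_map (incr_lift i).
Proof.
apply: lie_morphism_eq; [exact: coface_lie | exact: face_map_lie |].
move=> A; rewrite face_map_gen [LHS]lhat_map_gen; congr gen; exact: val_inj.
Qed.

Lemma incr_map_onto p n (f : incr_map p n) :
  f @: [set: _] = [set: _] -> p = n.
Proof.
move=> e; have := congr1 (fun A : {set _} => #|A|) e.
by rewrite card_imset ?cardsT ?card_ord => [[]|]; last exact: incr_inj.
Qed.

(** An increasing map that is not onto factors through a coface, and the only one
    that is onto is the identity. *)
Lemma face_map_dgl (D : forall n, {linear LDelta n -> LDelta n}) :
  (forall n (i : 'I_n.+2), dgl_morphism (D n) (D n.+1) (coface i)) ->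
  forall p n (f : incr_map p n) x, face_map f (D p x) = D n (face_map f x).
Proof.
move=> hD p n; elim: n => [|n IH] f x.
  have e : p = 0%N.
    have := max_card (mem (f @: [set: _])); rewrite card_imset; last exact: incr_inj.
    by rewrite cardsT !card_ord; case: p f x.
  subst p; have e := @eq_face_map _ _ f (incr_id 0) (fun i => etrans (ord1 _) (esym (ord1 _))).
  by rewrite !e !face_map_id.
have [/eqP onto|] := boolP (f @: [set: _] == [set: _]).
  have e := incr_map_onto onto; subst p.
  have {}e : face_map f =1 face_map (incr_id n.+1).
    apply/eq_face_map/incr_map_eq; rewrite onto.
    by apply/setP => i; rewrite inE; apply/esym/imsetP; exists i.
  by rewrite !e !face_map_id.
rewrite -subTset => /subsetPn [i _ ni].
have /choice [g hg] : forall k, exists j : 'I_n.+1, f k = lift i j.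
  move=> k; have [j ->|e] := unliftP i (f k); first by exists j.
  by case/negP: ni; rewrite -e; apply: imset_f; rewrite inE.
have gi (j k : 'I_p.+1) : (j < k)%N -> (g j < g k)%N.
  by move=> jk; rewrite (lift_lt i) -!hg; exact: incr_lt.
have e y : face_map f y = coface i (face_map (IncrMap gi) y).
  by rewrite coface_face_map face_map_comp; apply: eq_face_map => k; exact: hg.
by rewrite !e IH (hD n i).2.
Qed.

(** * Morphisms determined by their values on top faces *)

Section FaceFamilies.

Lemma setT_neq0 n : [set: 'I_n.+1] != set0.
Proof. by apply/set0Pn; exists ord0; rewrite inE. Qed.

Definition top n : simplex n := exist _ [set: 'I_n.+1] (setT_neq0 n).

Lemma gdeg_top n : gdeg (top n) = n%:Z - 1.
Proof. by rewrite gdeg_simplex cardsT card_ord; lia. Qed.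

Lemma image_face_top n (A : simplex n) : image_face (enum_map A) (top _) = A.
Proof. by apply: val_inj; exact: enum_map_image. Qed.

Lemma enum_map_dim n (A : simplex n) : A != top n -> (#|val A|.-1 < n)%N.
Proof.
move=> ne; rewrite prednK ?card_gt0 ?(valP A) //.
have : val A \proper [set: 'I_n.+1].
  rewrite properT; apply: contra ne => /eqP e; apply/eqP; exact: val_inj.
by move/proper_card; rewrite cardsT card_ord.
Qed.

Variable u : forall p, LDelta p.

Definition face_value n (A : simplex n) : LDelta n := face_map (enum_map A) (u #|val A|.-1).

(** An increasing map is determined by its image, so any parametrization of the
    face A gives the same value. *)
Lemma face_valueE p n (f : incr_map p n) (A : simplex n) :
  f @: [set: _] = val A -> face_value A = face_map f (u p).
Proof.
move=> e; have p_eq : p = #|val A|.-1.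
  by rewrite -e card_imset ?cardsT ?card_ord //; exact: incr_inj.
subst p; apply: eq_face_map; apply: incr_map_eq.
by rewrite e enum_map_image.
Qed.

Lemma face_value_image p n (f : incr_map p n) (A : simplex p) :
  face_value (image_face f A) = face_map f (face_value A).
Proof.
rewrite face_map_comp; apply: face_valueE => /=.
by rewrite -[in RHS](enum_map_image A) -imset_comp.
Qed.

Lemma face_value_top n : face_value (top n) = u n.
Proof.
rewrite (@face_valueE n n (incr_id n)) ?face_map_id //=; exact: imset_id.
Qed.

Definition family_map n : {linear LDelta n -> LDelta n} := lmor (@face_value n).

Lemma family_map_lie n : lie_morphism (family_map n).
Proof. exact: lmor_lie. Qed.

Hypothesis hu : forall p, homog (gdeg (top p)) (u p).

Lemma face_value_homog n (A : simplex n) : homog (gdeg A) (face_value A).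
Proof.
rewrite -[in gdeg A](image_face_top A) gdeg_image_face.
by apply: (face_map_lie _).1.
Qed.

Lemma family_map_gen n A : family_map n (gen A) = face_value A.
Proof. by apply: lmor_gen; exact: face_value_homog. Qed.

Lemma family_map_face p n (f : incr_map p n) x :
  family_map n (face_map f x) = face_map f (family_map p x).
Proof.
move: x; apply: (@lie_morphism_eq _ _ (family_map n \o face_map f)
  (face_map f \o family_map p)).
- by apply: lie_morphism_comp; [exact: family_map_lie | exact: face_map_lie].
- by apply: lie_morphism_comp; [exact: face_map_lie | exact: family_map_lie].
by move=> A; rewrite /= face_map_gen !family_map_gen face_value_image.
Qed.

Hypothesis gu : forall p, lhat_ge 2 (u p - gen (top p)).

Lemma face_value_ge n (A : simplex n) : lhat_ge 2 (face_value A - gen A).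
Proof.
rewrite -[in gen A](image_face_top A) -face_map_gen -linearB.
by apply: lie_morphism_ge; first exact: face_map_lie.
Qed.

End FaceFamilies.

Lemma eq_family_map (u w : forall p, LDelta p) n :
  (forall p, (p <= n)%N -> u p = w p) -> family_map u n = family_map w n.
Proof.
move=> e; rewrite /family_map; congr lmor; apply/funext => A.
rewrite /face_value e // -ltnS -card_simplex.
by apply: leq_trans (max_card _) _; rewrite card_ord.
Qed.

(** * Construction of the isomorphisms *)

Definition update_at (u : forall p, LDelta p) n (a : LDelta n) : forall p, LDelta p :=
  dfwith u a.

Section Construction.
Variables D D' : forall n : nat, {linear LDelta n -> LDelta n}.
Hypotheses (hD : compatible_models D) (hD' : compatible_models D').

Definition intertwined (u : forall p, LDelta p) n :=
  D' n (family_map u n (gen (top n))) = family_map u n (D n (gen (top n))).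

Lemma face_map_D p n (f : incr_map p n) x : face_map f (D p x) = D n (face_map f x).
Proof. by have [_ _ _ H] := hD; exact: face_map_dgl. Qed.

Lemma face_map_D' p n (f : incr_map p n) x : face_map f (D' p x) = D' n (face_map f x).
Proof. by have [_ _ _ H] := hD'; exact: face_map_dgl. Qed.

(** Every face is the image of a top face under a map that commutes with the
    differentials and with the morphisms of the family. *)
Lemma defect_face (u : forall p, LDelta p) n (A : simplex n) :
  (forall p, homog (gdeg (top p)) (u p)) -> intertwined u #|val A|.-1 ->
  defect (D n) (D' n) (family_map u n) (gen A) = 0.
Proof.
move=> hu e; rewrite defectE -(image_face_top A) -face_map_gen -face_map_D.
by rewrite !family_map_face // -face_map_D' e subrr.
Qed.

Lemma agen_set1_top0 (i : 'I_1) : agen [set i] = gen (top 0) :> LDelta 0.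
Proof.
have -> : [set i] = [set: 'I_1] by apply/setP => j; rewrite !inE !ord1.
by rewrite /agen (insubT (fun B : {set 'I_1} => B != set0) (setT_neq0 0)).
Qed.

(** Here D and D' agree, since a_0 is a Maurer-Cartan element for both. *)
Lemma intertwined0 (u : forall p, LDelta p) :
  (forall p, homog (gdeg (top p)) (u p)) -> u 0%N = gen (top 0) -> intertwined u 0.
Proof.
move=> hu u0; have [_ /(_ 0%N ord0) [_ e] _ _] := hD.
have [_ /(_ 0%N ord0) [_ e'] _ _] := hD'.
rewrite agen_set1_top0 in e e'.
have fT : family_map u 0 (gen (top 0)) = gen (top 0) by rewrite family_map_gen // face_value_top.
move/eqP: e; rewrite addr_eq0 => /eqP e; move/eqP: e'; rewrite addr_eq0 => /eqP e'.
rewrite /intertwined fT e e' linearN; congr (- _); rewrite linearZZ.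
by rewrite (family_map_lie u 0).2 fT.
Qed.

Lemma extend_family (u : forall p, LDelta p) n :
  (forall p, homog (gdeg (top p)) (u p)) ->
  (forall p, lhat_ge 2 (u p - gen (top p))) ->
  (forall p, (p < n)%N -> intertwined u p) ->
  exists a : LDelta n, [/\ homog (gdeg (top n)) a, lhat_ge 2 (a - gen (top n))
    & intertwined (update_at u a) n].
Proof.
case: n => [|n] hu gu int.
  exists (gen (top 0)); split; [exact: homog_gen | by rewrite subrr; exact: lhat_ge0 |].
  apply: intertwined0; last by rewrite /update_at dfwith_in.
  move=> p; rewrite /update_at; have [->|ne] := eqVneq 0%N p.
    by rewrite dfwith_in; exact: homog_gen.
  by rewrite dfwith_out.
have hw (a : LDelta n.+1) : homog (gdeg (top n.+1)) a -> forall p, homog (gdeg (top p)) (update_at u a p).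
  move=> ha p; have [e|ne] := eqVneq n.+1 p; last by rewrite /update_at dfwith_out.
  by move: p e => _ <-; rewrite /update_at dfwith_in.
have setE (a : LDelta n.+1) :
    lmor (setval (top n.+1) (@face_value u n.+1) a) = family_map (update_at u a) n.+1.
  congr lmor; apply/funext => A; rewrite /setval.
  have [->|ne] := eqVneq A (top n.+1); first by rewrite face_value_top /update_at dfwith_in.
  rewrite /face_value /update_at dfwith_out //.
  by rewrite gtn_eqF // enum_map_dim.
have [dD _ lD _] := hD; have [dD' _ lD' _] := hD'.
have dT : dDelta (val (top n.+1)) =
    \sum_(w : simplex n.+1) dcoef (val (top n.+1)) (val w) *: gen w := dDeltaE (top n.+1).
have [|||||||a [ha ga ea]] := @extension _ (top n.+1) (D n.+1) (D' n.+1) (@face_value u n.+1)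
    (fun w : simplex n.+1 => dcoef (val (top n.+1)) (val w)) (dD n.+1) (dD' n.+1).
- by move=> A; exact: face_value_homog.
- by move=> A; exact: face_value_ge.
- apply/eqP; apply: contraT => /dcoef_deg; lia.
- by rewrite -dT; exact: lD.
- by rewrite -dT; exact: lD'.
- move=> a A ne ha; rewrite setE; apply: defect_face; first exact: hw.
  have lt := enum_map_dim ne.
  have e : family_map (update_at u a) #|val A|.-1 = family_map u #|val A|.-1.
    apply: eq_family_map => p le; rewrite /update_at dfwith_out // gtn_eqF //.
    exact: leq_ltn_trans le lt.
  by rewrite /intertwined e; exact: int.
- move=> k e k1 he ge_e De.
  have [||w] := @simplex_acyclic n.+1 (D' n.+1) k (gdeg (top n.+1) - 1) e
    (dD' n.+1) (lD' n.+1) _ _ he ge_e De.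
  + exact: ltnW.
  + by rewrite gdeg_top; lia.
  + by rewrite subrK; exists w.
exists a; split=> //; rewrite /intertwined -setE.
by apply/eqP; rewrite -subr_eq0; apply/eqP.
Qed.

(** The value at n is chosen after those at p < n, on which alone the morphisms up
    to dimension n - 1 depend; so the choices stabilize. *)
Lemma intertwined_family : exists u : forall p, LDelta p,
  [/\ forall p, homog (gdeg (top p)) (u p), forall p, lhat_ge 2 (u p - gen (top p))
    & forall p, intertwined u p].
Proof.
pose ok (u : forall p, LDelta p) n := [/\ forall p, homog (gdeg (top p)) (u p),
  forall p, lhat_ge 2 (u p - gen (top p)) & forall p, (p < n)%N -> intertwined u p].
have /choice [next next_ok] : forall s : (forall p, LDelta p) * nat, exists w : forall p, LDelta p,
    ok s.1 s.2 -> ok w s.2.+1 /\ forall p, p != s.2 -> w p = s.1 p.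
  move=> [u n] /=; have [|no] := pselect (ok u n); last by exists u => /no.
  move=> [hu gu int]; have [a [ha ga ia]] := extend_family hu gu int.
  exists (update_at u a) => _; split; last first.
    by move=> p ne; rewrite /update_at dfwith_out // eq_sym.
  split=> p.
  - have [e|ne] := eqVneq n p; last by rewrite /update_at dfwith_out.
    by move: p e => _ <-; rewrite /update_at dfwith_in.
  - have [e|ne] := eqVneq n p; last by rewrite /update_at dfwith_out.
    by move: p e => _ <-; rewrite /update_at dfwith_in.
  - rewrite ltnS leq_eqVlt => /orP [/eqP ->//|lt].
    rewrite /intertwined (@eq_family_map _ u) ?int // => q le.
    by rewrite /update_at dfwith_out // gtn_eqF // (leq_ltn_trans le lt).
pose st := fix st n : forall p, LDelta p :=
  if n is n'.+1 then next (st n', n') else fun p => gen (top p).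
have st_ok n : ok (st n) n.
  elim: n => [|n IH]; last by have [] := next_ok (st n, n) IH.
  by split=> // p; [exact: homog_gen | rewrite subrr; exact: lhat_ge0].
have stE n m p : (p < n)%N -> st (n + m)%N p = st n p.
  move=> lt; elim: m => [|m IH]; first by rewrite addn0.
  rewrite addnS /= (next_ok (st _, _) (st_ok _)).2 //= neq_ltn.
  by rewrite (leq_trans lt) // leq_addr.
exists (fun p => st p.+1 p); split=> p; try by have [] := st_ok p.+1.
have e : family_map (fun q => st q.+1 q) p = family_map (st p.+1) p.
  by apply: eq_family_map => q le; rewrite -(subnKC le) -addSn stE.
by rewrite /intertwined e; have [_ _ H] := st_ok p.+1; exact: H.
Qed.

End Construction.

Theorem theorem2p8 (D D' : forall n : nat, {linear LDelta n -> LDelta n})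
    (hD : compatible_models D) (hD' : compatible_models D') :
  exists phi : forall n : nat, {linear LDelta n -> LDelta n},
    [/\ forall n : nat, dgl_isomorphism (D n) (D' n) (phi n),
        forall (n : nat) (i : 'I_n.+2) (x : LDelta n),
          phi n.+1 (coface i x) = coface i (phi n x)
      & forall (n : nat) (x : LDelta n), lhat_ge 2 (phi n x - x)].
Proof.
have [u [hu gu int]] := intertwined_family hD hD'.
have phi2 n (A : simplex n) : lhat_ge 2 (family_map u n (gen A) - gen A).
  by rewrite family_map_gen //; exact: face_value_ge.
exists (family_map u); split=> [n|n i x|n x].
- apply: unipotent_dgl_isomorphism => //; first exact: family_map_lie.
  have [dD _ _ _] := hD; have [dD' _ _ _] := hD'.
  apply: (defect_gen_eq0 (dD n) (dD' n) (family_map_lie u n)) => A.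
  exact: defect_face.
- by rewrite !coface_face_map family_map_face.
- by apply: (@unipotent_ge _ _ (family_map_lie u n) (phi2 n) 0); exact: lhat_ge1.
Qed.
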